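(* Let $R'=\mathbb{Z}[\rho][x_0,\ldots,x_{p-2}]$ be a polynomial ring, with $\tau$ extended to $R'$ by $\tau(x_i)=x_i$. Let $z=\sum_{i=0}^{p-2}x_i\rho^i$, $C=\prod_{i=0}^{p-2}\tau^i(1+z\eta^p)$, $R=R'[1/C]$, $u=N(z)$, and $S=R[Z]/(Z^p+g(Z)-u)$ with $\theta$ the image of $Z$; then $S/R$ is Galois with group $\langle\sigma\rangle$, $\sigma(\theta)=\rho\theta+1$. Setting $$\tau(\theta)=\tfrac1\delta\bigl((s*\theta)\ominus (r*_pz)\eta^{p-1}\bigr)$$ defines an extension of the action of $\tau$ on $R$ to a ring automorphism $\tau$ of $S$ with $\tau^{p-1}=1$ and $\sigma\tau=\tau\sigma$. Moreover, $S^{\tau}/R^{\tau}$ is Galois with group $\langle\sigma\rangle$.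
   Context: $p$ is a prime, $\rho$ is a primitive $p$-th root of one, $\mathbb{Z}[\rho]=\mathbb{Z}[X]/(X^{p-1}+\cdots+1)$, $\eta=\rho-1$. There is a unit $\xi\in\mathbb{Z}[\rho]^*$ with $p=\xi\eta^{p-1}$. Put $b_i=\binom{p}{i}/p$ for $1\le i\le p-1$ and $g(Z)=\xi\sum_{i=1}^{p-1} b_i\eta^{i-1}Z^i\in\mathbb{Z}[\rho][Z]$. $\tau$ is the automorphism of $\mathbb{Z}[\rho]$ induced by a generator of $\mathrm{Gal}(\mathbb{Q}(\rho)/\mathbb{Q})$; $s$ is a positive integer with $\tau(\rho)=\rho^s$, chosen so that $s^{p-1}-1=pr$ with $r$ prime to $p$; $\delta=(\rho^s-1)/(\rho-1)=1+\rho+\cdots+\rho^{s-1}$, a unit of $\mathbb{Z}[\rho]$. In any commutative $\mathbb{Z}[\rho]$-algebra: $x\oplus y=x+y+xy\eta$; if $1+y\eta$ is a unit, $x\ominus y$ is the unique $w$ with $x=y\oplus w$, i.e. $(x-y)/(1+y\eta)$; $x\oplus_py=x+y+xy\eta^p$; for a positive integer $n$, $n*x=x\oplus\cdots\oplus x$ and $n*_px=x\oplus_p\cdots\oplus_px$ ($n$ summands each). Write $\delta^p\tau$ for the map $w\mapsto\delta^p\cdot\tau(w)$. Define $$N(z)=(s^{p-2}*_pz)\oplus_p(s^{p-3}*_p\delta^p\tau(z))\oplus_p\cdots\oplus_p(s*_p(\delta^p\tau)^{p-3}(z))\oplus_p(\delta^p\tau)^{p-2}(z).$$ ''Galois'' is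 in the sense of Galois extensions of commutative rings. *)

(* Defs.v *)
From HB Require Import structures.
From mathcomp Require Import all_boot all_order all_algebra all_fingroup.
From mathcomp Require Import all_solvable all_field.
From mathcomp Require Import mpoly.

Set Implicit Arguments.
Unset Strict Implicit.
Unset Printing Implicit Defensive.

Import GRing.Theory.
Local Open Scope ring_scope.

(* The quotients {poly %/ h} used below have no canonical [unitRingType]
   structure, so units are described by the existence of an inverse. *)
Definition is_unit (A : comNzRingType) (a : A) : Prop :=
  exists b : A, a * b = 1.

Definition cyclo (p : nat) : {poly int} := \poly_(i < p) 1.

(* For p >= 2, [cyclo p] is monic of positive degree, so this is the genuine
   quotient Z[X]/(X^(p-1) + ... + 1). *)
Notation Zrho p := {poly %/ cyclo p}.

Definition rhoZ (p : nat) : Zrho p := 'qX.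
Definition etaZ (p : nat) : Zrho p := rhoZ p - 1.
Definition deltaZ (p s : nat) : Zrho p := \sum_(i < s) rhoZ p ^+ i.

(* The restriction to Z[rho] of a generator of Gal(Q(rho)/Q); here L = Q(zeta)
   with zeta a primitive p-th root of one, and emb sends rho to zeta. *)
Definition gal_generator (p : nat) (tau : {rmorphism Zrho p -> Zrho p}) : Prop :=
  exists (L : splittingFieldType rat) (zeta : L)
         (emb : {rmorphism Zrho p -> L}) (g : gal_of {:L}),
    [/\ p.-primitive_root zeta,
        <<1%VS; zeta>>%VS = fullv,
        emb (rhoZ p) = zeta,
        generator 'Gal({:L} / 1%VS) g
      & forall a, emb (tau a) = g (emb a)].

Definition gpoly (p : nat) (xi : Zrho p) : {poly Zrho p} :=
  xi *: \sum_(1 <= i < p) (('C(p, i) %/ p)%:R * etaZ p ^+ i.-1) *: 'X^i.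

(* The operations below depend on a scalar e: the unsubscripted ones are for
   e = eta, the ones with subscript p for e = eta^p. *)
Definition oplus (A : comNzRingType) (e x y : A) : A := x + y + x * y * e.

Definition nmul (A : comNzRingType) (e : A) (n : nat) (x : A) : A :=
  iterop n (oplus e) x 0.

Definition is_ominus (A : comNzRingType) (e x y w : A) : Prop :=
  is_unit (1 + y * e) /\ unique (fun w' => x = oplus e y w') w.

Section Generic.
Variables (p s : nat) (tau : {rmorphism Zrho p -> Zrho p}).

Notation R' := {mpoly (Zrho p)[p.-1]}.

Definition tau' : {rmorphism R' -> R'} := map_mpoly tau.

Definition zgen : R' := \sum_(i < p.-1) 'X_i * (rhoZ p ^+ i)%:MP.

Definition Cgen : R' :=
  \prod_(i < p.-1) iter i tau' (1 + zgen * (etaZ p ^+ p)%:MP).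

Definition Nmap (z : R') : R' :=
  let e := (etaZ p ^+ p)%:MP in
  let dtau w := (deltaZ p s ^+ p)%:MP * tau' w in
  \big[oplus e/0]_(i < p.-1) nmul e (s ^ (p.-2 - i)) (iter i dtau z).

End Generic.

(* iota : A -> B exhibits B as the localization A[1/c]. *)
Definition is_localization_away (A B : comNzRingType) (c : A)
    (iota : {rmorphism A -> B}) : Prop :=
  [/\ is_unit (iota c),
      forall b, exists (a : A) (n : nat), b * iota c ^+ n = iota a
    & forall a, iota a = 0 -> exists n : nat, c ^+ n * a = 0].

(* Galois extensions of commutative rings, in the sense of
   Chase, Harrison and Rosenberg. *)
Definition galois_ext (A B : comNzRingType) (f : {rmorphism A -> B})
    (G : finGroupType) (to : {action G &-> B}) : Prop :=
  [/\ forall g : G, zmod_morphism (to^~ g) /\ monoid_morphism (to^~ g),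
      injective f,
      forall b : B, (forall g : G, to b g = b) <-> (exists a : A, b = f a)
    & exists (m : nat) (x y : 'I_m -> B),
        forall g : G, \sum_(i < m) x i * to (y i) g = (g == 1%g)%:R].

(* B/A is Galois with group <sigma>, cyclic of order n. *)
Definition galois_cyclic (A B : comNzRingType) (f : {rmorphism A -> B})
    (sigma : {rmorphism B -> B}) (n : nat) : Prop :=
  exists (G : finGroupType) (g : G) (to : {action G &-> B}),
    [/\ #[g]%g = n, <[g]>%g = [set: G], forall b, to b g = sigma b
      & galois_ext f to].

Section FixedRing.
Variables (A : comNzRingType) (t : {rmorphism A -> A}).

Definition fixed_by : pred A := fun x => t x == x.

Lemma fixed_subring_closed : subring_closed fixed_by.
Proof.
split=> [|x y|x y]; rewrite !unfold_in /fixed_by ?rmorph1 //.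
  by move=> /eqP hx /eqP hy; rewrite rmorphB hx hy.
by move=> /eqP hx /eqP hy; rewrite rmorphM hx hy.
Qed.

HB.instance Definition _ :=
  GRing.isSubringClosed.Build A fixed_by fixed_subring_closed.

Record fixring : predArgType := Fixring {
  fixval :> A;
  _ : fixed_by fixval
}.

HB.instance Definition _ := [isSub for fixval].
HB.instance Definition _ := [Choice of fixring by <:].
HB.instance Definition _ := [SubChoice_isSubComNzRing of fixring by <:].

End FixedRing.

(* The morphism A^tA -> B^tB induced by an equivariant morphism A -> B. *)
Section FixedMap.
Variables (A B : comNzRingType).
Variables (tA : {rmorphism A -> A}) (tB : {rmorphism B -> B}).
Variables (h : {rmorphism A -> B}) (hE : forall a, h (tA a) = tB (h a)).

Lemma fixmap_subproof (x : fixring tA) : fixed_by tB (h (val x)).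
Proof. by apply/eqP; rewrite -hE (eqP (valP x)). Qed.

Definition fixmap (x : fixring tA) : fixring tB := Fixring (fixmap_subproof x).

Lemma fixmap_is_zmod_morphism : zmod_morphism fixmap.
Proof. by move=> x y; apply: val_inj; rewrite /= !rmorphB. Qed.

Lemma fixmap_is_monoid_morphism : monoid_morphism fixmap.
Proof.
by split=> [|x y]; apply: val_inj; rewrite /= ?rmorph1 ?rmorphM.
Qed.

HB.instance Definition _ :=
  GRing.isZmodMorphism.Build (fixring tA) (fixring tB) fixmap
    fixmap_is_zmod_morphism.
HB.instance Definition _ :=
  GRing.isMonoidMorphism.Build (fixring tA) (fixring tB) fixmap
    fixmap_is_monoid_morphism.

End FixedMap.

(* Main.v *)
(* Write Theta = 1 + eta theta and Z = 1 + eta^p z.  Since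
   1 + eta (x (+) y) = (1 + eta x) (1 + eta y) and p = xi eta^(p-1), the equation
   of theta says Theta^p = U with U = 1 + eta^p u, that is
   U = prod_i tau^i(Z)^(s^(p-2-i)); moreover sigma(Theta) = rho Theta and
   tau(Theta) = Theta^s / Z^r.  Hence tau(U) Z^(s^(p-1)) = U^s Z makes tau well
   defined, and every identity about sigma and tau can be checked on Theta
   because eta is regular in S (p is, and eta divides p).

   S/R is Galois because theta - sigma^k(theta) is a unit: it is Theta times a
   unit of Z[rho].  For the descent one shows, for 0 < k < p, that the ideal I of
   S^tau generated by the y - sigma^k(y) is the unit ideal.
   - p lies in I: let P be an integral Lagrange polynomial, with P(rho) = p and
     P(rho^(s^j)) = 0 for 0 < j < p-1.  Writing T for the trace of tau,
     sum_l P_l T(rho^l b) = p b.  Take b = theta - sigma^k(theta), a unit, and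
     return to S^tau using T(-rho) = 1.
   - I is the unit ideal modulo p: tau(theta) = theta modulo eta, so y = T(theta)
     satisfies y - sigma^k(y) = k + n with n divisible by eta.  Then n^(p-1) is
     divisible by eta^(p-1), hence by p, and k^(p-1) = 1 modulo p. *)

Require Import Defs.
From HB Require Import structures.
From mathcomp Require Import all_boot all_order all_algebra all_fingroup.
From mathcomp Require Import all_solvable all_field.
From mathcomp Require Import mpoly.
From mathcomp Require Import ring.

Set Implicit Arguments.
Unset Strict Implicit.
Unset Printing Implicit Defensive.

Import GRing.Theory.
Local Open Scope ring_scope.

(** * Galois extensions with cyclic group *)

Section IterMorphism.
Variables (B : comNzRingType) (t : {rmorphism B -> B}) (n : nat).

Lemma iter_is_zmod_morphism : zmod_morphism (iter n t).
Proof. by move=> x y; elim: n => //= m ->; rewrite rmorphB. Qed.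

Lemma iter_is_monoid_morphism : monoid_morphism (iter n t).
Proof.
split=> [|x y]; first by elim: n => //= m ->; rewrite rmorph1.
by elim: n => //= m ->; rewrite rmorphM.
Qed.

HB.instance Definition _ :=
  GRing.isZmodMorphism.Build B B (iter n t) iter_is_zmod_morphism.
HB.instance Definition _ :=
  GRing.isMonoidMorphism.Build B B (iter n t) iter_is_monoid_morphism.

End IterMorphism.

Lemma iter_modn (T : Type) (t : T -> T) p n b :
  (forall x, iter p t x = x) -> iter (n %% p) t b = iter n t b.
Proof.
move=> tp; rewrite {2}(divn_eq n p) addnC iterD; congr (iter _ _ _).
by elim: (n %/ p)%N => //= m IH; rewrite mulSn iterD tp.
Qed.

Section MovedIdeal.
Variables (B : comNzRingType) (t : {rmorphism B -> B}).

(** The ideal generated by all [y - t y]. It contains 1 exactly when [t] induces the identity modulo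
    no maximal ideal, which is the Chase-Harrison-Rosenberg condition on [t]. *)
Definition moved_ideal (a : B) : Prop :=
  exists l : seq (B * B), a = \sum_(q <- l) q.1 * (q.2 - t q.2).

Lemma moved_idealB y : moved_ideal (y - t y).
Proof. by exists [:: (1, y)]; rewrite big_seq1 mul1r. Qed.

Lemma moved_idealD a b : moved_ideal a -> moved_ideal b -> moved_ideal (a + b).
Proof. by case=> l -> [m ->]; exists (l ++ m); rewrite big_cat. Qed.

Lemma moved_idealMl c a : moved_ideal a -> moved_ideal (c * a).
Proof.
case=> l ->; exists [seq (c * q.1, q.2) | q <- l].
by rewrite big_map mulr_sumr; apply: eq_bigr => q _; rewrite mulrA.
Qed.

Lemma moved_ideal_sum (I : Type) (r : seq I) (F : I -> B) :
  (forall i, moved_ideal (F i)) -> moved_ideal (\sum_(i <- r) F i).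
Proof.
move=> HF; elim: r => [|i r IH].
  by rewrite big_nil; exists [::]; rewrite big_nil.
by rewrite big_cons; apply: moved_idealD.
Qed.

End MovedIdeal.

(* Each non-trivial power of [s] is killed by one tensor in [B (x) B]; the
   coordinates are the product of these tensors. *)
Lemma galois_coordinates (B : comNzRingType) (s : {rmorphism B -> B}) p :
  (forall k, (0 < k < p)%N -> moved_ideal (iter k s) 1) ->
  exists l : seq (B * B),
    forall k, (k < p)%N -> \sum_(q <- l) q.1 * iter k s q.2 = (k == 0)%:R.
Proof.
move=> Hk.
suff H n : exists l : seq (B * B),
    forall k, (k < p)%N -> (k < n)%N -> \sum_(q <- l) q.1 * iter k s q.2 = (k == 0)%:R.
  by have [l Hl] := H p; exists l => k kp; apply: Hl.
elim: n => [|n [l Hl]]; first by exists [::].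
have [pn|np] := leqP p n.
  by exists l => k kp _; apply: Hl => //; apply: leq_trans pn.
have [n0|n_gt0] := posnP n.
  exists [:: (1, 1)] => k _; rewrite n0 ltnS leqn0 => /eqP->.
  by rewrite big_seq1 /= mul1r.
have [|m Hm] := Hk n; first by rewrite n_gt0.
(* The extra pair makes the sum vanish at [k = n]; at [k = 0] it becomes the given combination of
   the [q.2 - iter n s q.2], hence 1. *)
pose m' := (- \sum_(q <- m) q.1 * iter n s q.2, 1) :: m.
have m'E k : \sum_(q <- m') q.1 * iter k s q.2 =
    \sum_(q <- m) q.1 * iter k s q.2 - \sum_(q <- m) q.1 * iter n s q.2.
  by rewrite big_cons /= rmorph1 mulr1 addrC.
exists [seq (a.1 * b.1, a.2 * b.2) | a <- l, b <- m'] => k kp.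
have -> : \sum_(q <- [seq (a.1 * b.1, a.2 * b.2) | a <- l, b <- m'])
    q.1 * iter k s q.2 =
    (\sum_(q <- l) q.1 * iter k s q.2) * (\sum_(q <- m') q.1 * iter k s q.2).
  rewrite big_allpairs_dep big_distrlr /=.
  by apply: eq_bigr => a _; apply: eq_bigr => b _; rewrite rmorphM mulrACA.
rewrite ltnS leq_eqVlt => /orP[/eqP->|kn].
  by rewrite m'E subrr mulr0 gtn_eqF.
rewrite Hl //; case: eqP => [k0|_]; last by rewrite mul0r.
rewrite mul1r m'E k0 /= -sumrB Hm.
by apply: eq_bigr => q _; rewrite mulrBr.
Qed.

(** Once the moved ideals are trivial, [galois_coordinates] supplies the coordinates; the rest is to
    present the iterates of [s] as an action of ['Z_p]. *)
Lemma galois_cyclicI (A B : comNzRingType) (f : {rmorphism A -> B})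
    (s : {rmorphism B -> B}) (p : nat) :
  prime p -> (forall b, iter p s b = b) -> injective f ->
  (forall a, s (f a) = f a) -> (forall b, s b = b -> exists a, b = f a) ->
  (forall k, (0 < k < p)%N -> moved_ideal (iter k s) 1) ->
  galois_cyclic f s p.
Proof.
move=> p_pr sp f_inj sf fixs /galois_coordinates[l Hl].
have p_gt1 := prime_gt1 p_pr.
pose act b (g : 'Z_p) := iter g s b.
have ltp (g : 'Z_p) : (g < p)%N by rewrite -[X in (_ < X)%N](Zp_cast p_gt1).
have act1 : act^~ 1%g =1 id by [].
(* The group law adds modulo [(Zp_trunc p).+2], which is p because p > 1; [iter_modn] absorbs the
   reduction. *)
have actM b (g h : 'Z_p) : act b (g * h)%g = act (act b g) h.
  rewrite /act -iterD [(h + g)%N]addnC -[RHS](iter_modn (g + h) _ sp).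
  by rewrite -[LHS]/(iter ((g + h) %% (Zp_trunc p).+2) s b)
    -[in X in _ = iter (_ %% X)%N _ _](Zp_cast p_gt1).
have s1 b : act b (1%R : 'Z_p) = s b by [].
exists 'Z_p, (1%R : 'Z_p), (TotalAction act1 actM); split => //.
- by rewrite [#[_]%g]order_Zp1 Zp_cast.
- by rewrite [RHS]Zp_cycle.
split => //.
- by move=> g; split; [apply: iter_is_zmod_morphism|apply: iter_is_monoid_morphism].
- move=> b; split=> [fixb|[a ->] g].
    by apply: fixs; apply: (fixb (1%R : 'Z_p)).
  by rewrite /= /act; elim: (g : nat) => //= m ->.
exists (size l), (fun i => (tnth (in_tuple l) i).1),
  (fun i => (tnth (in_tuple l) i).2) => g.
rewrite -(big_tnth _ _ l xpredT (fun q => q.1 * act q.2 g)) Hl //.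
Qed.

(** * Morphisms out of quotients and localizations *)

Section QpolyMorphism.
Variables (A : comNzRingType) (h : {poly A}).
Hypotheses (h_gt1 : (1 < size h)%N) (h_monic : h \is monic).

Lemma mk_monicE : mk_monic h = h.
Proof. by rewrite /mk_monic h_gt1 h_monic. Qed.

Lemma in_qpolyK (q : {poly %/ h}) : in_qpoly h q = q.
Proof. by apply: val_inj; rewrite /= Pdiv.CommonRing.rmodp_small // size_mk_monic. Qed.

Lemma in_qpolyE P : in_qpoly h P = (map_poly (qpolyC h) P).['qX].
Proof.
elim/poly_ind: P => [|P c IH]; first by rewrite !rmorph0 horner0.
rewrite !rmorphD !rmorphM /= map_polyX map_polyC hornerD hornerM hornerX hornerC.
rewrite -IH; congr (_ + _); apply: val_inj.
rewrite /= Pdiv.CommonRing.rmodp_small //.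
by rewrite size_polyC (leq_ltn_trans (leq_b1 _)) ?size_mk_monic_gt1.
Qed.

Lemma qpoly_horner (q : {poly %/ h}) :
  q = (map_poly (qpolyC h) (q : {poly A})).['qX].
Proof. by rewrite -in_qpolyE in_qpolyK. Qed.

Lemma size_qpoly (q : {poly %/ h}) : (size (q : {poly A}) < size h)%N.
Proof. by apply: leq_trans (size_mk_monic q) _; rewrite mk_monicE. Qed.

Lemma in_qpoly_monic : in_qpoly h h = 0.
Proof. by apply: val_inj; rewrite /= mk_monicE Pdiv.RingMonic.rmodpp. Qed.

Lemma qpoly_root : (map_poly (qpolyC h) h).['qX] = 0.
Proof. by rewrite -in_qpolyE in_qpoly_monic. Qed.

Lemma qpolyC_inj : injective (qpolyC h).
Proof. by move=> a b /(congr1 (@qpoly.polyn _ _))/polyC_inj. Qed.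

(** Torsion is tested on the coefficients of the reduced representative. *)
Lemma qpoly_reg n : (forall a : A, a *+ n = 0 -> a = 0) ->
  forall q : {poly %/ h}, q *+ n = 0 -> q = 0.
Proof.
move=> nreg q /(congr1 (@qpoly.polyn _ _)); rewrite raddfMn /= => q0.
apply: val_inj; apply/polyP=> i; rewrite coef0; apply: nreg.
by rewrite -coefMn q0 coef0.
Qed.

Lemma qpoly_ext (B : comNzRingType) (F G : {rmorphism {poly %/ h} -> B}) :
  (forall a, F (qpolyC h a) = G (qpolyC h a)) -> F 'qX = G 'qX -> F =1 G.
Proof.
move=> FGC FGX q; rewrite (qpoly_horner q) -!horner_map FGX -!map_poly_comp.
by congr (_.[_]); apply: eq_map_poly.
Qed.

Section Lift.
Variables (B : comNzRingType) (phi : {rmorphism A -> B}) (b : B).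
Hypothesis hb : (map_poly phi h).[b] = 0.

Definition qpoly_eval (q : {poly %/ h}) : B := (map_poly phi q).[b].

Lemma qpoly_eval_in P : qpoly_eval (in_qpoly h P) = (map_poly phi P).[b].
Proof.
rewrite /qpoly_eval /= mk_monicE [in RHS](Pdiv.RingMonic.rdivp_eq h_monic P).
by rewrite rmorphD rmorphM hornerD hornerM hb mulr0 add0r.
Qed.

Lemma qpoly_eval_is_zmod_morphism : zmod_morphism qpoly_eval.
Proof.
move=> q r; rewrite /qpoly_eval.
rewrite -[qpoly.polyn _]/((q : {poly A}) - (r : {poly A})).
by rewrite rmorphB hornerD hornerN.
Qed.

Lemma qpoly_eval_is_monoid_morphism : monoid_morphism qpoly_eval.
Proof.
split=> [|q r]; first by rewrite /qpoly_eval /= rmorph1 hornerC.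
rewrite -[q * r]/(in_qpoly h ((q : {poly A}) * r)) qpoly_eval_in.
by rewrite rmorphM hornerM.
Qed.

HB.instance Definition _ :=
  GRing.isZmodMorphism.Build {poly %/ h} B qpoly_eval qpoly_eval_is_zmod_morphism.
HB.instance Definition _ :=
  GRing.isMonoidMorphism.Build {poly %/ h} B qpoly_eval
    qpoly_eval_is_monoid_morphism.

Lemma qpoly_lift : exists F : {rmorphism {poly %/ h} -> B},
  (forall a, F (qpolyC h a) = phi a) /\ F 'qX = b.
Proof.
exists (qpoly_eval : {rmorphism _ -> _}); split=> [a|].
  by rewrite /= /qpoly_eval /= map_polyC hornerC.
by rewrite /= qpoly_eval_in map_polyX hornerX.
Qed.

End Lift.
End QpolyMorphism.

Section Localization.
Variables (A B C : comNzRingType) (c : A) (iota : {rmorphism A -> B}).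
Hypothesis Bloc : is_localization_away c iota.

(** After the denominator of [b] is cleared, some power of [c] kills n times the numerator, hence
    kills the numerator itself. *)
Lemma localization_reg n : (forall a : A, a *+ n = 0 -> a = 0) ->
  forall b : B, b *+ n = 0 -> b = 0.
Proof.
move=> nreg b b0; have [[v cv] fracB iota0] := Bloc; have [a [m bE]] := fracB b.
have [k ck] : exists k, c ^+ k * (a *+ n) = 0.
  by apply: iota0; rewrite rmorphMn /= -bE -mulrnAl b0 mul0r.
have ck0 : c ^+ k * a = 0 by apply: nreg; rewrite -mulrnAr.
have vc i : iota c ^+ i * v ^+ i = 1 by rewrite -exprMn cv expr1n.
have a0 : iota a = 0.
  by rewrite -[LHS]mul1r -(vc k) mulrAC -rmorphXn -rmorphM ck0 rmorph0 mul0r.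
by rewrite -[b]mulr1 -(vc m) mulrA bE a0 mul0r.
Qed.

Variable phi : {rmorphism A -> C}.
Hypothesis phi_unit : is_unit (phi c).

Let frac_ex b : exists q : A * nat, b * iota c ^+ q.2 == iota q.1.
Proof. by have [_ /(_ b)[a [n /eqP e]] _] := Bloc; exists (a, n). Qed.

Let inv_ex : exists v, phi c * v == 1.
Proof. by have [v /eqP] := phi_unit; exists v. Qed.

(** The localization property only asserts that fractions exist, so a numerator, an exponent and an
    inverse of [phi c] are chosen; [localization_mapP] shows that the value does not depend on
    them. *)
Definition localization_map (b : B) : C :=
  let q := xchoose (frac_ex b) in phi q.1 * xchoose inv_ex ^+ q.2.

Lemma localization_mapP b a n :
  b * iota c ^+ n = iota a -> localization_map b * phi c ^+ n = phi a.
Proof.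
rewrite /localization_map; case: (xchoose _) (xchooseP (frac_ex b)) => a' m /=.
move=> /eqP e' e; set v := xchoose _.
have cv i : phi c ^+ i * v ^+ i = 1.
  by rewrite -exprMn (eqP (xchooseP inv_ex)) expr1n.
(* Two fractions for [b] agree after multiplication by some [c ^+ k], which [phi] makes
   invertible. *)
have [_ _ /(_ (a' * c ^+ n - a * c ^+ m))[|k]] := Bloc.
  rewrite rmorphB !rmorphM !rmorphXn -e -e' -!mulrA.
  by rewrite [iota c ^+ n * _]mulrC subrr.
move/(congr1 phi); rewrite rmorphM rmorphB rmorphXn !rmorphM !rmorphXn rmorph0.
move/(congr1 ( *%R (v ^+ k))); rewrite mulr0 mulrA [v ^+ k * _]mulrC cv mul1r.
by move/eqP; rewrite subr_eq0 => /eqP E; rewrite mulrAC E -mulrA cv mulr1.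
Qed.

Lemma localization_map_uniq b a n x :
  b * iota c ^+ n = iota a -> x * phi c ^+ n = phi a -> localization_map b = x.
Proof.
move=> /localization_mapP; have [v cv] := phi_unit => <- /(congr1 ( *%R^~ (v ^+ n))).
by rewrite -!mulrA -exprMn cv expr1n !mulr1.
Qed.

Lemma localization_map_is_zmod_morphism : zmod_morphism localization_map.
Proof.
move=> x y; have [_ frac _] := Bloc.
have [[a [m ea]] [b [n eb]]] := (frac x, frac y).
apply: (@localization_map_uniq _ (a * c ^+ n - b * c ^+ m) (m + n)).
  rewrite rmorphB !rmorphM !rmorphXn -ea -eb exprD mulrBl !mulrA.
  by rewrite [in RHS](mulrAC y).
rewrite rmorphB !rmorphM !rmorphXn -(localization_mapP ea) -(localization_mapP eb).
by rewrite exprD mulrBl !mulrA [in RHS](mulrAC (localization_map y)).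
Qed.

Lemma localization_map_is_monoid_morphism : monoid_morphism localization_map.
Proof.
split=> [|x y].
  by apply: (@localization_map_uniq _ 1 0); rewrite expr0 ?rmorph1 mulr1.
have [_ frac _] := Bloc; have [[a [m ea]] [b [n eb]]] := (frac x, frac y).
apply: (@localization_map_uniq _ (a * b) (m + n)).
  by rewrite rmorphM -ea -eb exprD mulrACA.
by rewrite rmorphM -(localization_mapP ea) -(localization_mapP eb) exprD mulrACA.
Qed.

HB.instance Definition _ := GRing.isZmodMorphism.Build B C localization_map
  localization_map_is_zmod_morphism.
HB.instance Definition _ := GRing.isMonoidMorphism.Build B C localization_map
  localization_map_is_monoid_morphism.

Lemma localization_lift : exists F : {rmorphism B -> C},
  forall a, F (iota a) = phi a.
Proof.
exists (localization_map : {rmorphism _ -> _}) => a /=.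
by apply: (@localization_map_uniq _ a 0); rewrite expr0 mulr1.
Qed.

End Localization.

Lemma localization_ext (A B C : comNzRingType) (c : A)
    (iota : {rmorphism A -> B}) (F G : {rmorphism B -> C}) :
  is_localization_away c iota -> (forall a, F (iota a) = G (iota a)) -> F =1 G.
Proof.
move=> [[v cv] frac _] FG b; have [a [n e]] := frac b.
have := FG a; rewrite -e !rmorphM !rmorphXn FG => /(congr1 ( *%R^~ (G v ^+ n))).
by rewrite -!mulrA -exprMn -rmorphM cv rmorph1 expr1n !mulr1.
Qed.

(** * The Galois group of the cyclotomic field *)

(** Irreducibility of X^(p-1) + ... + 1 over Q, as a degree bound: a complex root of [q] is a
    primitive p-th root of one, and its minimal polynomial, of degree p - 1, divides [q]. *)
Lemma cyclotomic_factor_size (p : nat) (q : {poly rat}) : prime p ->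
  q %| \poly_(i < p) 1 -> (size q != 1)%N -> (p <= size q)%N.
Proof.
move=> p_pr qdvd sq; have p_gt0 := prime_gt0 p_pr.
have q_neq0 : q != 0.
  apply: contraTneq qdvd => ->; rewrite dvd0p; apply/eqP => /polyP/(_ 0%N)/eqP.
  by rewrite coef_poly coef0 p_gt0 oner_eq0.
have [x rx] : exists x : algC, root (map_poly ratr q) x.
  by apply/closed_rootP; rewrite size_map_poly.
have Phi_sum : \sum_(i < p) x ^+ i = 0.
  have: root (map_poly ratr (\poly_(i < p) 1 : {poly rat})) x.
    rewrite -dvdp_XsubCl in rx; rewrite -dvdp_XsubCl; apply: (dvdp_trans rx).
    by rewrite dvdp_map.
  rewrite poly_def rmorph_sum => /rootP; rewrite horner_sum => Phi0; rewrite -[RHS]Phi0.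
  by apply: eq_bigr => i _; rewrite /= scale1r map_polyXn hornerXn.
have xp1 : x ^+ p = 1.
  by apply/eqP; rewrite -subr_eq0 subrX1 Phi_sum mulr0.
have [m prim_x m_dvd] := prim_order_exists p_gt0 xp1.
have m_p : m = p.
  (* Order 1 would mean x = 1, where the cyclotomic sum takes the value p. *)
  have/primeP[_ /(_ m m_dvd)/orP[/eqP m1|/eqP//]] := p_pr.
  move: Phi_sum; have -> : x = 1 by have := prim_expr_order prim_x; rewrite m1.
  rewrite (eq_bigr (fun=> 1)) => [|i _]; last by rewrite expr1n.
  rewrite sumr_const card_ord => /eqP.
  by rewrite Num.Theory.pnatr_eq0 gtn_eqF.
have [r [rE _] rdvd] := minCpolyP x.
have : size r = p.
  rewrite -(size_map_poly (ratr : {rmorphism rat -> algC})) -rE.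
  rewrite (minCpoly_cyclotomic prim_x) size_cyclotomic m_p totient_prime //.
  by rewrite prednK.
by move=> <-; apply: dvdp_leq => //; rewrite -rdvd.
Qed.

(** If s^m = 1 modulo p, then [g ^+ m] fixes zeta, which generates L, and so is trivial; but [g] has
    order [L : Q], which irreducibility bounds below by p - 1. Thus s is a primitive root modulo
    p. *)
Lemma gal_generator_order (p s m : nat) (tau : {rmorphism Zrho p -> Zrho p}) :
  prime p -> gal_generator tau -> tau (rhoZ p) = rhoZ p ^+ s ->
  (0 < m)%N -> s ^ m = 1 %[mod p] -> (p.-1 <= m)%N.
Proof.
move=> p_pr [L [zeta [emb [g [prim_z genL emb_rho gen_g emb_tau]]]]] tau_rho.
move=> m_gt0 sm; set G := ('Gal({:L} / 1%VS))%g in gen_g.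
have gG : g \in G by rewrite (eqP gen_g) cycle_id.
have gz : g zeta = zeta ^+ s by rewrite -emb_rho -emb_tau tau_rho rmorphXn.
have gXz k : (g ^+ k)%g zeta = zeta ^+ (s ^ k).
  elim: k => [|k IH]; first by rewrite expg0 gal_id expn0.
  by rewrite expgSr galM ?memvf // IH rmorphXn /= gz -exprM -expnS.
have gm1 : (g ^+ m = 1)%g.
  apply/eqP/gal_eqP => a _.
  have /Fadjoin1_polyP[P ->] : a \in <<1; zeta>>%VS by rewrite genL memvf.
  rewrite gal_id -horner_map /= gXz -map_poly_comp.
  congr (_.[_]); last by rewrite -(prim_expr_mod prim_z) sm (prim_expr_mod prim_z).
  by apply: eq_map_poly => c /=; rewrite linearZ rmorph1.
have galL : galois 1 {:L}.
  rewrite /galois sub1v normalFieldf andbT /=.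
  apply/separableP=> u _; apply: pcharf0_separable.
  by move=> q; rewrite (pchar_lalg L) Num.Theory.pchar_num.
have oG : #|G| = adjoin_degree 1 zeta.
  by rewrite /G -(galois_dim galL) adjoin_degreeE genL.
have g_m : (#[g]%g <= m)%N by rewrite dvdn_leq // order_dvdn gm1.
apply: leq_trans g_m; rewrite orderE -(eqP gen_g) oG.
have p_gt0 := prime_gt0 p_pr.
have /polyOver1P[q qE] := minPolyOver 1 zeta.
have sq : size q = (adjoin_degree 1 zeta).+1.
  by rewrite -size_minPoly qE size_map_poly.
(* The minimal polynomial of zeta comes from [q] over the rationals and divides the cyclotomic sum,
   so the degree bound applies to it. *)
rewrite -ltnS -sq prednK //; apply: cyclotomic_factor_size => //; last first.
  by rewrite sq eqSS -lt0n.
rewrite -(dvdp_map (in_alg L)) -qE minPoly_dvdp ?alg_polyOver //.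
have z_neq1 : zeta - 1 != 0.
  by rewrite subr_eq0 -[zeta]expr1 -(prim_order_dvd prim_z) dvdn1 gtn_eqF ?prime_gt1.
apply/rootP/(mulfI z_neq1); rewrite mulr0 -[RHS](subrr 1).
rewrite -{2}(prim_expr_order prim_z) subrX1; congr (_ * _).
rewrite poly_def rmorph_sum horner_sum.
by apply: eq_bigr => i _; rewrite /= scale1r map_polyXn hornerXn.
Qed.

(** * Cyclotomic integers *)

Section CyclotomicIntegers.
Variables (p : nat) (p_pr : prime p).
Notation rho := (rhoZ p).
Notation eta := (etaZ p).

Let p_gt0 : (0 < p)%N := prime_gt0 p_pr.
Let p_gt1 : (1 < p)%N := prime_gt1 p_pr.

Lemma size_cyclo : size (cyclo p) = p.
Proof. by rewrite size_poly_eq // oner_eq0. Qed.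

Lemma cyclo_monic : cyclo p \is monic.
Proof. by rewrite monicE lead_coefE size_cyclo coef_poly prednK // leqnn. Qed.

Let cyclo_gt1 : (1 < size (cyclo p))%N.
Proof. by rewrite size_cyclo. Qed.

Lemma horner_cyclo (B : comNzRingType) (phi : {rmorphism int -> B}) x :
  (map_poly phi (cyclo p)).[x] = \sum_(i < p) x ^+ i.
Proof.
rewrite /cyclo poly_def rmorph_sum horner_sum.
by apply: eq_bigr => i _; rewrite /= scale1r map_polyXn hornerXn.
Qed.

Lemma sum_rho : \sum_(i < p) rho ^+ i = 0.
Proof. by rewrite -(horner_cyclo (qpolyC _)) qpoly_root ?cyclo_monic. Qed.

Lemma rho_expp : rho ^+ p = 1.
Proof. by apply/eqP; rewrite -subr_eq0 subrX1 sum_rho mulr0. Qed.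

Lemma rho_exp_mod n : rho ^+ (n %% p) = rho ^+ n.
Proof. exact: expr_mod rho_expp. Qed.

Lemma Zrho_reg (x : Zrho p) : x *+ p = 0 -> x = 0.
Proof.
apply: qpoly_reg => a /eqP.
by rewrite Num.Theory.mulrn_eq0 gtn_eqF //= => /eqP.
Qed.

Lemma Zrho_ext (B : comNzRingType) (F G : {rmorphism Zrho p -> B}) :
  F rho = G rho -> F =1 G.
Proof.
apply: qpoly_ext => a.
by rewrite -[a]intz !rmorph_int.
Qed.

Lemma etaE : 1 + eta = rho.
Proof. by rewrite addrC subrK. Qed.

Lemma rho_exp_eta n : rho ^+ n = 1 + eta * deltaZ p n.
Proof. by rewrite addrC -subrX1 subrK. Qed.

Lemma tau_eta (t : {rmorphism Zrho p -> Zrho p}) s :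
  t rho = rho ^+ s -> t eta = deltaZ p s * eta.
Proof. by move=> trho; rewrite rmorphB rmorph1 trho subrX1 mulrC. Qed.

(** Each of the n powers of rho is 1 modulo eta. *)
Lemma deltaZ_mod_eta n : exists e, deltaZ p n = n%:R + eta * e.
Proof.
elim: n => [|n [e en]]; first by exists 0; rewrite /deltaZ big_ord0 mulr0 addr0.
exists (e + deltaZ p n).
rewrite {1}/deltaZ big_ord_recr /= -/(deltaZ p n) {1}en rho_exp_eta; ring.
Qed.

Section Ramification.
Variables (xi : Zrho p) (xi_eq : p%:R = xi * eta ^+ p.-1).

(** Multiplication by xi eta^(p-2) turns eta into p. *)
Lemma eta_reg (B : comNzRingType) (psi : {rmorphism Zrho p -> B}) :
  (forall b : B, b *+ p = 0 -> b = 0) -> forall b, psi eta * b = 0 -> b = 0.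
Proof.
move=> preg b eb0; apply: preg; rewrite -mulr_natl -(rmorph_nat psi) xi_eq.
have -> : p.-1 = p.-2.+1 by rewrite prednK // -ltnS prednK.
by rewrite exprSr mulrA rmorphM -mulrA eb0 mulr0.
Qed.

(** The inverse is (rho^(kt) - 1)/(rho^k - 1) with kt = 1 modulo p: after multiplication by the
    regular element eta the claim is rho^(kt) = rho. *)
Lemma deltaZ_unit k : coprime k p -> is_unit (deltaZ p k).
Proof.
move=> co_kp; pose t := (k ^ (totient p).-1)%N.
have kt : (k * t = 1 %[mod p])%N.
  rewrite /t -expnS prednK ?totient_gt0 //; exact: Euler_exp_totient.
exists (\sum_(i < t) (rho ^+ k) ^+ i); apply/eqP; rewrite -subr_eq0; apply/eqP.
apply: (eta_reg (psi := idfun) Zrho_reg) => /=.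
rewrite mulrBr mulr1 mulrA -subrX1 -subrX1 -exprM -rho_exp_mod kt rho_exp_mod.
by rewrite expr1 subrr.
Qed.

Section Order.
Variables (s : nat) (s_p : coprime s p).
Hypothesis s_order : forall m, (0 < m)%N -> s ^ m = 1 %[mod p] -> (p.-1 <= m)%N.

Let s_gt0 : (0 < s)%N.
Proof.
rewrite lt0n; apply: contraTneq s_p => ->.
by rewrite /coprime gcd0n gtn_eqF.
Qed.

(** Cancelling the smaller power, prime to p, leaves s^(j-i) = 1 modulo p; if i and j differed,
    [s_order] would force j - i to be at least p - 1. *)
Lemma expn_mod_inj i j : (i < p.-1)%N -> (j < p.-1)%N ->
  s ^ i = s ^ j %[mod p] -> i = j.
Proof.
move=> ip jp e; wlog le_ij : i j ip jp e / (i <= j)%N.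
  by move=> IH; case: (leqP i j) => [|/ltnW] h; [|symmetry]; apply: IH.
apply/eqP; rewrite eqn_leq le_ij -subn_eq0 /=; apply: contraTT jp => ji_neq0.
rewrite -leqNgt; apply: leq_trans (leq_subr i j).
apply: s_order; first by rewrite lt0n.
have := e; rewrite -{1}(subnKC le_ij) expnD -{1}[(s ^ i)%N]muln1.
move/eqP; rewrite eq_sym eqn_mod_dvd ?leq_pmul2l ?expn_gt0 ?s_gt0 //.
rewrite -mulnBr Gauss_dvdr ?coprimeXr 1?coprime_sym //.
by rewrite -eqn_mod_dvd ?expn_gt0 ?s_gt0 // => /eqP.
Qed.

(** The residues of the s^j run through 1, ..., p - 1, so this is [sum_rho] without the term 1. It
    makes -rho an element of trace 1. *)
Lemma sum_rho_conj : \sum_(j < p.-1) rho ^+ (s ^ j) = -1.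
Proof.
have s_mod j : (0 < s ^ j %% p)%N.
  rewrite lt0n; apply/eqP=> sj0; have := coprimeXl j s_p.
  by rewrite -coprime_modl sj0 /coprime gcd0n gtn_eqF.
have lt_h (j : 'I_p.-1) : ((s ^ j %% p).-1 < p.-1)%N.
  by rewrite -ltnS !prednK // ltn_mod.
(* Lowering the nonzero residue by one lands in ['I_p.-1], so that injectivity alone allows
   reindexing. *)
pose h j := Ordinal (lt_h j).
have hE j : (h j).+1 = (s ^ j %% p)%N by rewrite /= prednK.
have h_inj : injective h.
  by move=> i j hij; apply/ord_inj/expn_mod_inj => //; rewrite -!hE hij.
rewrite (eq_bigr (fun j => rho ^+ (h j).+1)); last first.
  by move=> j _; rewrite hE rho_exp_mod.
have := reindex_inj (F := fun i : 'I_p.-1 => rho ^+ i.+1) (P := xpredT) h_inj.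
move=> /= <-.
apply/eqP; rewrite -subr_eq0 opprK; apply/eqP; rewrite -[RHS]sum_rho.
have := p_gt0; case: (p) => // q _.
by rewrite [RHS]big_ord_recl addrC expr0.
Qed.

(** The product of the p - 2 factors X - rho^(s^j), 0 < j < p - 1, takes at rho the value eta^(p-2)
    up to a unit, since each rho - rho^(s^j) is eta times a unit. One more eta and the factor xi
    give p. *)
Lemma rho_lagrange : exists P : {poly Zrho p},
  P.[rho] = p%:R /\ forall j, (0 < j < p.-1)%N -> P.[rho ^+ (s ^ j)] = 0.
Proof.
pose P n := \prod_(k < n) ('X - (rho ^+ (s ^ k.+1))%:P).
have root_P n j : (0 < j <= n)%N -> (P n).[rho ^+ (s ^ j)] = 0.
  move=> /andP[j_gt0 jn]; have jn' : (j.-1 < n)%N by rewrite prednK.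
  rewrite horner_prod (bigD1 (Ordinal jn')) //= prednK //.
  by rewrite hornerXsubC subrr mul0r.
have P_rho n : (n < p.-1)%N -> exists e, (P n).[rho] * e = eta ^+ n.
  elim: n => [|n IH] np; first by exists 1; rewrite /P big_ord0 hornerC mulr1.
  have [e eE] := IH (ltnW np).
  have sn_gt0 : (0 < s ^ n.+1)%N by rewrite expn_gt0 s_gt0.
  have [|d dE] := @deltaZ_unit (s ^ n.+1 - 1).
    rewrite coprime_sym prime_coprime // -eqn_mod_dvd //.
    apply/negP=> /eqP h.
    by have := @expn_mod_inj n.+1 0 np (leq_ltn_trans (leq0n _) np) h.
  (* The new factor is rho - rho^(m+1) = - rho eta D with m + 1 = s^(n+1) and D = [deltaZ p m]; [d]
     inverts D and rho^(p-1) inverts rho. *)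
  exists (- (e * d * rho ^+ p.-1)).
  rewrite /P big_ord_recr /= -/(P n) hornerM hornerXsubC exprSr -eE.
  rewrite -[in rho ^+ (s ^ n.+1)](subnK sn_gt0) addn1 exprSr rho_exp_eta.
  have rp : rho ^+ p.-1 * rho = 1 by rewrite -exprSr prednK // rho_expp.
  set D := deltaZ _ _ in dE *.
  transitivity ((P n).[rho] * e * eta * (D * d) * (rho ^+ p.-1 * rho)).
    by ring.
  by rewrite dE rp !mulr1.
have p2 : (p.-2 < p.-1)%N by rewrite -ltnS prednK // -ltnS prednK.
have [e eE] := P_rho p.-2 p2; exists ((e * xi * eta) *: P p.-2); split.
  have -> : (e * xi * eta *: P p.-2).[rho] = xi * ((P p.-2).[rho] * e * eta).
    by rewrite hornerZ; ring.
  by rewrite eE -exprSr xi_eq; congr (_ * _ ^+ _); rewrite prednK // -ltnS prednK.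
move=> j /andP[j_gt0 jp]; rewrite hornerZ root_P ?mulr0 // j_gt0.
by rewrite -ltnS prednK // -ltnS prednK.
Qed.

End Order.
End Ramification.
End CyclotomicIntegers.

(** * The Kummer equation and descent along tau *)

Section Kummer.
Variables (p : nat) (p_pr : prime p).
Notation rho := (rhoZ p).
Notation eta := (etaZ p).
Variables (xi : Zrho p) (xi_eq : p%:R = xi * eta ^+ p.-1).
Variables (B : comNzRingType) (psi : {rmorphism Zrho p -> B}).

Let p_gt0 : (0 < p)%N := prime_gt0 p_pr.

(** The binomial coefficients are p b_i, and p eta = xi eta^p, so the inner terms of the expansion
    of (1 + eta b)^p are eta^p times those of g(b). *)
Lemma kummer_id (b : B) :
  psi eta ^+ p * (b ^+ p + (map_poly psi (gpoly xi)).[b]) =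
    (1 + psi eta * b) ^+ p - 1.
Proof.
rewrite exprDn big_ord_recl /= bin0 expr0 expr1n mulr1 mulr1n [RHS]addrC addKr.
have -> : (map_poly psi (gpoly xi)).[b] =
    psi xi * \sum_(i < p.-1) (('C(p, i.+1) %/ p)%:R * psi eta ^+ i) * b ^+ i.+1.
  rewrite /gpoly map_polyZ hornerZ rmorph_sum horner_sum /= big_add1 big_mkord.
  congr (_ * _); apply: eq_bigr => i _.
  rewrite map_polyZ hornerZ map_polyXn hornerXn rmorphM rmorphXn.
  by rewrite rmorph_nat.
have pE : psi eta ^+ p * psi xi = p%:R * psi eta.
  have -> : psi eta ^+ p = psi eta ^+ p.-1 * psi eta by rewrite -exprSr prednK.
  by rewrite -(rmorph_nat psi) xi_eq rmorphM rmorphXn; ring.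
rewrite mulrDr addrC mulrA pE.
transitivity (\sum_(i < p.-1.+1)
    1 ^+ (p - bump 0 i) * (psi eta * b) ^+ bump 0 i *+ 'C(p, bump 0 i)); last first.
  by rewrite (prednK p_gt0).
rewrite big_ord_recr /= /bump /= add1n prednK // binn mulr1n expr1n mul1r exprMn.
congr (_ + _); rewrite mulr_sumr; apply: eq_bigr => i _.
rewrite add1n expr1n mul1r.
have i_p : (0 < i.+1 < p)%N by rewrite /= -[X in (_ < X)%N](prednK p_gt0) ltnS.
rewrite -[in RHS](divnK (prime_dvd_bin p_pr i_p)) -[RHS]mulr_natr natrM exprMn.
by rewrite !exprS; ring.
Qed.

Variables (sigma : {rmorphism B -> B}) (theta : B).
Hypotheses (sigma_psi : forall a, sigma (psi a) = psi a)
  (sigma_theta : sigma theta = psi rho * theta + 1).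

Lemma iter_sigma_psi k a : iter k sigma (psi a) = psi a.
Proof. by elim: k => //= k ->. Qed.

Lemma iter_sigma_theta k :
  iter k sigma theta = psi (rho ^+ k) * theta + psi (deltaZ p k).
Proof.
elim: k => [|k IH].
  by rewrite /deltaZ big_ord0 rmorph0 rmorph1 mul1r addr0.
rewrite iterS IH rmorphD rmorphM !sigma_psi sigma_theta.
rewrite /deltaZ big_ord_recr /= exprSr !rmorphM rmorphD /=.
by move: (psi (rho ^+ k)) (psi (\sum_(i < k) _)) (psi rho) => x y z; ring.
Qed.

Lemma theta_sub_iter k :
  theta - iter k sigma theta = - psi (deltaZ p k) * (1 + psi eta * theta).
Proof.
have -> : iter k sigma theta =
    (1 + psi eta * psi (deltaZ p k)) * theta + psi (deltaZ p k).
  by rewrite iter_sigma_theta rho_exp_eta [in LHS]rmorphD rmorph1 rmorphM.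
by move: (psi eta) (psi (deltaZ p k)) => x y; ring.
Qed.

Hypothesis theta_unit : is_unit (1 + psi eta * theta).

(** By [theta_sub_iter] the difference is Theta times minus a cyclotomic unit. *)
Lemma theta_sub_iter_unit k : coprime k p -> is_unit (theta - iter k sigma theta).
Proof.
move=> /(deltaZ_unit p_pr xi_eq)[d dE]; have [v vE] := theta_unit.
exists (- psi d * v); rewrite theta_sub_iter.
transitivity (psi (deltaZ p k * d) * ((1 + psi eta * theta) * v)).
  by rewrite rmorphM; ring.
by rewrite vE dE rmorph1 mulr1.
Qed.

End Kummer.

Section Descent.
Variables (p : nat) (p_pr : prime p).
Notation rho := (rhoZ p).
Notation eta := (etaZ p).
Variables (xi : Zrho p) (xi_unit : is_unit xi) (xi_eq : p%:R = xi * eta ^+ p.-1).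
Variables (s : nat) (s_p : coprime s p).
Hypothesis s_order : forall m, (0 < m)%N -> s ^ m = 1 %[mod p] -> (p.-1 <= m)%N.
Variables (tau0 : {rmorphism Zrho p -> Zrho p}).
Hypothesis tau0_rho : tau0 rho = rho ^+ s.
Variables (B : comNzRingType) (psi : {rmorphism Zrho p -> B}).
Variables (sigma tau : {rmorphism B -> B}) (theta : B).
Hypotheses (p_reg : forall b : B, b *+ p = 0 -> b = 0)
  (sigma_tau : forall b, sigma (tau b) = tau (sigma b))
  (tau_order : forall b, iter p.-1 tau b = b)
  (sigma_psi : forall a, sigma (psi a) = psi a)
  (tau_psi : forall a, tau (psi a) = psi (tau0 a))
  (sigma_theta : sigma theta = psi rho * theta + 1)
  (theta_unit : is_unit (1 + psi eta * theta))
  (tau_theta : exists t, tau theta = theta + psi eta * t).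

Let p_gt0 : (0 < p)%N := prime_gt0 p_pr.

Definition trace (b : B) : B := \sum_(j < p.-1) iter j tau b.

Lemma trace_fixed b : fixed_by tau (trace b).
Proof.
rewrite /fixed_by /trace rmorph_sum -subr_eq0 -sumrB.
have -> : \sum_(i < p.-1) (tau (iter i tau b) - iter i tau b) =
    \sum_(0 <= i < p.-1) (iter i.+1 tau b - iter i tau b) by rewrite big_mkord.
by rewrite telescope_sumr //= tau_order subrr.
Qed.

Definition ftrace (b : B) : fixring tau := Fixring (trace_fixed b).

Lemma trace_mul (x y : B) : tau y = y -> trace (x * y) = trace x * y.
Proof.
move=> ty; rewrite /trace mulr_suml; apply: eq_bigr => j _; rewrite rmorphM /=.
by congr (_ * _); elim: (j : nat) => //= m ->.
Qed.

Lemma trace_sum (I : Type) (r : seq I) (F : I -> B) :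
  trace (\sum_(i <- r) F i) = \sum_(i <- r) trace (F i).
Proof.
rewrite /trace exchange_big /=.
by apply: eq_bigr => j _; rewrite rmorph_sum.
Qed.

Lemma iter_tau_psi j n : iter j tau (psi (rho ^+ n)) = psi (rho ^+ (s ^ j) ^+ n).
Proof.
elim: j => [|j IH]; first by rewrite expn0 expr1.
rewrite iterS IH tau_psi; congr (psi _).
by rewrite !rmorphXn /= tau0_rho -!exprM expnS ?mulnA.
Qed.

Lemma iter_sigma_tau k j b :
  iter k sigma (iter j tau b) = iter j tau (iter k sigma b).
Proof.
have comm1 c : sigma (iter j tau c) = iter j tau (sigma c).
  by elim: j => //= j <-; rewrite sigma_tau.
by elim: k => //= k ->; rewrite comm1.
Qed.

Lemma iter_sigma_trace k b : iter k sigma (trace b) = trace (iter k sigma b).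
Proof.
by rewrite /trace rmorph_sum; apply: eq_bigr => j _; rewrite /= iter_sigma_tau.
Qed.

Lemma iter_tau_theta j : exists t, iter j tau theta = theta + psi eta * t.
Proof.
have [t0 t0E] := tau_theta.
elim: j => [|j [t tE]]; first by exists 0; rewrite mulr0 addr0.
exists (t0 + psi (deltaZ p s) * tau t).
rewrite iterS tE rmorphD rmorphM t0E tau_psi (tau_eta tau0_rho) rmorphM; ring.
Qed.

Lemma trace_theta : exists t, trace theta = p.-1%:R * theta + psi eta * t.
Proof.
rewrite /trace; elim: p.-1 => [|n [t tE]].
  by exists 0; rewrite big_ord0 mul0r mulr0 addr0.
have [t' t'E] := iter_tau_theta n; exists (t + t').
by rewrite big_ord_recr /= tE t'E -natr1; ring.
Qed.

Variables (sigmaF : {rmorphism fixring tau -> fixring tau}).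
Hypothesis sigmaFE : forall x, fixval (sigmaF x) = sigma (fixval x).

Lemma fixval_iter_sigmaF k x :
  fixval (iter k sigmaF x) = iter k sigma (fixval x).
Proof. by elim: k => // m IH; rewrite !iterS sigmaFE IH. Qed.

Variables (k : nat) (k_p : (0 < k < p)%N).

Let co_kp : coprime k p.
Proof.
by case/andP: k_p => k_gt0 kp; rewrite coprime_sym prime_coprime // gtnNdvd.
Qed.

(* [Z[1/p][rho]] is Galois over [Z[1/p]], so only primes above [p] can obstruct
   descent along [tau]. *)
Lemma descent_p : moved_ideal (iter k sigmaF) p%:R.
Proof.
have [P [P1 P0]] := rho_lagrange p_pr xi_eq s_p s_order.
have [V VE] := theta_sub_iter_unit p_pr xi_eq sigma_psi sigma_theta theta_unit co_kp.
pose Y l := psi (rho ^+ l) * theta.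
(* [V] undoes the unit theta - sigma^k(theta), the coefficients of P select the identity among the
   powers of tau, and -rho has trace 1. *)
pose a l := - psi rho * V * psi P`_l.
suff -> : p%:R = \sum_(l < size P)
    ftrace (a l) * (ftrace (Y l) - iter k sigmaF (ftrace (Y l))).
  by apply: moved_ideal_sum => l; apply/moved_idealMl/moved_idealB.
apply: val_inj; rewrite rmorph_nat rmorph_sum.
(* This trace is p times that of -rho, hence p. It is then expanded by linearity of the trace over
   the fixed ring. *)
transitivity (trace (- psi rho * V * (p%:R * (theta - iter k sigma theta)))).
  have -> : - psi rho * V * (p%:R * (theta - iter k sigma theta)) = - psi rho * p%:R.
    transitivity (- psi rho * p%:R * ((theta - iter k sigma theta) * V)).
      by ring.
    by rewrite VE mulr1.
  rewrite trace_mul ?rmorph_nat // /trace.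
  rewrite (eq_bigr (fun j : 'I__ => - psi (rho ^+ (s ^ j)))); last first.
    by move=> j _; rewrite rmorphN /= -[rho in LHS]expr1 iter_tau_psi.
  by rewrite sumrN -rmorph_sum (sum_rho_conj p_pr s_p s_order) rmorphN1 opprK mul1r.
have fixY l : tau (trace (Y l) - iter k sigma (trace (Y l))) =
    trace (Y l) - iter k sigma (trace (Y l)).
  by rewrite rmorphB iter_sigma_trace !(eqP (trace_fixed _)).
rewrite [RHS](eq_bigr (fun l : 'I__ =>
    trace (a l * (trace (Y l) - iter k sigma (trace (Y l)))))); last first.
  by move=> l _; rewrite trace_mul ?fixY // rmorphM rmorphB /= fixval_iter_sigmaF.
rewrite -trace_sum; congr trace.
transitivity (- psi rho * V * \sum_(l < size P)
    psi P`_l * (trace (Y l) - iter k sigma (trace (Y l)))); last first.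
  by rewrite mulr_sumr; apply: eq_bigr => l _; rewrite mulrA.
congr (_ * _); symmetry.
(* Exchanging the two sums turns the coefficient of the j-th tau-conjugate into P(rho^(s^j)), which
   is p for j = 0 and 0 otherwise. *)
rewrite (eq_bigr (fun l : 'I_(size P) => \sum_(j < p.-1)
   psi (P`_l * rho ^+ (s ^ j) ^+ l) * iter j tau (theta - iter k sigma theta))).
  rewrite exchange_big /=.
  rewrite (eq_bigr (fun j : 'I_p.-1 => psi (P.[rho ^+ (s ^ j)]) *
     iter j tau (theta - iter k sigma theta))); last first.
    by move=> j _; rewrite -mulr_suml -rmorph_sum -horner_coef.
  have p1_gt0 : (0 < p.-1)%N by rewrite -ltnS prednK // prime_gt1.
  rewrite (bigD1 (Ordinal p1_gt0)) //= expn0 expr1 P1 rmorph_nat.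
  rewrite big1 ?addr0 // => j j_neq0; rewrite P0 ?rmorph0 ?mul0r // ltn_ord andbT.
  by rewrite lt0n.
move=> l _; rewrite iter_sigma_trace -/(trace _) /trace -sumrB mulr_sumr.
apply: eq_bigr => j _; rewrite -rmorphB /Y rmorphM /= iter_sigma_psi //.
by rewrite -mulrBr rmorphM /= iter_tau_psi rmorphM mulrA.
Qed.

Lemma fermat_natr (A : comNzRingType) : exists m, k%:R ^+ p.-1 = 1 + p%:R * m :> A.
Proof.
exists (k ^ p.-1 %/ p)%:R.
have kE : (k ^ p.-1 %% p = 1)%N.
  rewrite -(modn_small (prime_gt1 p_pr)) -(totient_prime p_pr).
  exact: Euler_exp_totient.
by rewrite -natrX {1}(divn_eq (k ^ p.-1) p) kE natrD natrM addrC mulrC.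
Qed.

Lemma descent_moved : moved_ideal (iter k sigmaF) 1.
Proof.
have [t tE] := trace_theta; pose y := ftrace theta.
have [xi' xiE] := xi_unit; have [e eE] := deltaZ_mod_eta p k.
pose M := y - iter k sigmaF y.
have valM : exists u, fixval M = k%:R + psi eta * u.
  pose q := psi xi * psi eta ^+ p.-2.
  have pE : p%:R = psi eta * q :> B.
    rewrite /q mulrCA -exprS -(rmorph_nat psi) xi_eq rmorphM rmorphXn.
    by congr (_ * _ ^+ _); rewrite prednK // -ltnS prednK // prime_gt1.
  have p1E : p.-1%:R = psi eta * q - 1 :> B.
    by rewrite -pE -[in RHS](prednK p_gt0) -natr1 addrK.
  have dE : psi (deltaZ p k) = k%:R + psi eta * psi e.
    by rewrite eE rmorphD rmorphM rmorph_nat.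
  (* Here theta - sigma^k(theta) is - delta_k Theta and the trace contributes the factor p - 1 = eta
     q - 1; the signs cancel and delta_k = k + eta e leaves the residue k. *)
  exists (t - iter k sigma t + psi e
     - q * (k%:R + psi eta * psi e) * (1 + psi eta * theta)
     + (k%:R + psi eta * psi e) * theta).
  rewrite -[fixval M]/(fixval y - fixval (iter k sigmaF y)).
  rewrite fixval_iter_sigmaF -[fixval y]/(trace theta) tE.
  have -> : iter k sigma (p.-1%:R * theta + psi eta * t) =
      p.-1%:R * iter k sigma theta + psi eta * iter k sigma t.
    by rewrite [LHS]rmorphD !rmorphM rmorph_nat /= iter_sigma_psi.
  have := theta_sub_iter sigma_psi sigma_theta k; rewrite dE p1E.
  move: (iter k sigma theta) (iter k sigma t) (psi eta) (psi e) => x1 x2 x3 x4 hx.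
  have -> : x1 = theta + (k%:R + x3 * x4) * (1 + x3 * theta).
    by rewrite -[x1](subKr theta) hx; ring.
  ring.
have [u uE] := valM; pose n := M - k%:R.
have nE : fixval n = psi eta * u.
  rewrite -[fixval n]/(fixval M - fixval k%:R).
  have kE : val (k%:R : fixring tau) = k%:R by rewrite rmorph_nat.
  by rewrite uE -[fixval k%:R]/(val (k%:R : fixring tau)) kE addrC addKr.
(* This is n^(p-1)/p, as p = xi eta^(p-1). *)
pose t3 := psi xi' * u ^+ p.-1.
have t3E : p%:R * t3 = fixval n ^+ p.-1.
  rewrite nE exprMn -(rmorph_nat psi) xi_eq rmorphM rmorphXn /t3.
  transitivity (psi (xi * xi') * (psi eta ^+ p.-1 * u ^+ p.-1)).
    by rewrite rmorphM; ring.
  by rewrite xiE rmorph1 mul1r.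
(* Divisibility by p descends to the fixed ring: p [t3] is fixed and p is regular. *)
have t3_fixed : fixed_by tau t3.
  rewrite /fixed_by -subr_eq0; apply/eqP/p_reg.
  rewrite -mulr_natl mulrBr t3E -[p%:R](rmorph_nat tau) -rmorphM t3E rmorphXn.
  by rewrite (eqP (valP n)) subrr.
have nI : n ^+ p.-1 = p%:R * Fixring t3_fixed.
  by apply: val_inj; rewrite rmorphXn rmorphM rmorph_nat -t3E.
have [m mE] := fermat_natr (fixring tau).
(* A difference of equal powers is divisible by the difference of the bases, here k + n = M. *)
have kX : k%:R ^+ p.-1 = (- n) ^+ p.-1 + M *
    \sum_(i < p.-1) k%:R ^+ (p.-1.-1 - i) * (- n) ^+ i.
  by rewrite -[X in X * \sum_(i < _) _](_ : k%:R - - n = _) -?subrXX ?subrKC //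
    /n opprK addrC subrK.
have -> : 1 = (- 1) ^+ p.-1 * Fixring t3_fixed * p%:R - m * p%:R +
    (\sum_(i < p.-1) k%:R ^+ (p.-1.-1 - i) * (- n) ^+ i) * M.
  have := kX; rewrite mE [(- n) ^+ p.-1]exprNn nI => h.
  rewrite -[LHS](addrK (p%:R * m)) h.
  move: (\sum_(i < _) _) ((-1) ^+ _) (Fixring _) => x1 x2 x3; ring.
rewrite -mulrBl; apply: moved_idealD; apply: moved_idealMl.
  exact: descent_p.
exact: moved_idealB.
Qed.
End Descent.

(** * Root counting and fixed elements of a quotient *)

(** In the presence of zero divisors, linear factors can still be split off successively when the
    differences of the roots are regular. *)
Lemma poly_eq0_of_roots (B : comNzRingType) (x : nat -> B) n (P : {poly B}) :
  (size P <= n)%N -> (forall i, (i < n)%N -> P.[x i] = 0) ->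
  (forall i j, (i < j < n)%N -> forall b, (x i - x j) * b = 0 -> b = 0) -> P = 0.
Proof.
elim: n P => [|n IH] P sP Px reg; first by apply/eqP; rewrite -size_poly_leq0.
have /factor_theorem[Q PE] : root P (x n) by apply/rootP/Px.
suff Q0 : Q = 0 by rewrite PE Q0 mul0r.
apply: IH => [|i i_n|i j /andP[ij jn]].
- have [->|Q_neq0] := eqVneq Q 0; first by rewrite size_poly0.
  move: sP; rewrite PE size_Mmonic ?monicXsubC // size_XsubC addn2 /=.
  by [].
- apply: (reg i n); first by rewrite i_n ltnSn.
  have := Px i (ltnW i_n); rewrite PE hornerM hornerXsubC => <-.
  by rewrite mulrC.
- by apply: reg; rewrite ij ltnS ltnW.
Qed.

(** If s fixes b, the reduced representative of b takes the value b at all n + 1 conjugates of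
    ['qX]. Its degree is at most n, so it is constant and its constant coefficient represents b. *)
Lemma qpoly_fixed (A : comNzRingType) (h : {poly A}) n
    (s : {rmorphism {poly %/ h} -> {poly %/ h}}) :
  h \is monic -> size h = n.+2 ->
  (forall a, s (qpolyC h a) = qpolyC h a) ->
  (forall i j, (i < j < n.+1)%N ->
     forall b, (iter i s 'qX - iter j s 'qX) * b = 0 -> b = 0) ->
  forall b, s b = b -> exists a, b = qpolyC h a.
Proof.
move=> h_monic sh sC reg b sb; have h_gt1 : (1 < size h)%N by rewrite sh.
exists (b : {poly A})`_0.
pose P := map_poly (qpolyC h) (b : {poly A}) - b%:P.
have P0 : P = 0.
  apply: (poly_eq0_of_roots (x := fun i => iter i s 'qX) (n := n.+1)) => //.
    rewrite (leq_trans (size_polyD _ _)) // geq_max size_polyN size_polyC.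
    rewrite (leq_trans (leq_b1 _)) // andbT (leq_trans (size_poly _ _)) //.
    by rewrite -ltnS -sh size_qpoly.
  move=> i _; have iterb : iter i s b = b by elim: i => //= i ->.
  rewrite hornerD hornerN hornerC -{2}iterb {2}(qpoly_horner b) -horner_map.
  rewrite -map_poly_comp; apply/eqP; rewrite subr_eq0; apply/eqP.
  by congr (_.[_]); apply: eq_map_poly => a /=; elim: (i) => //= m <-; rewrite sC.
have := congr1 (fun Q : {poly _} => Q`_0) P0.
by rewrite coefB coef_map coefC coef0 => /eqP; rewrite subr_eq0 eq_sym => /eqP.
Qed.

(** * Multiplicative forms of the operations and of N *)

Lemma nmul_id (A : comNzRingType) (e x : A) n :
  1 + e * nmul e n x = (1 + e * x) ^+ n.
Proof.
rewrite /nmul; case: n => [|n]; first by rewrite mulr0 addr0.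
rewrite iteropS; elim: n => [|n IH]; first by rewrite expr1.
by rewrite iterS exprS -IH /oplus; ring.
Qed.

(** Since t(e) = d e, the map x -> 1 + e x carries the twisted map w -> d t(w) to t itself and sums
    for [oplus] to products. With e = eta^p and d = delta^p this computes U. *)
Lemma norm_id (A : comNzRingType) (t : {rmorphism A -> A}) (e d z : A) (n s : nat) :
  t e = d * e ->
  1 + e * \big[oplus e/0]_(i < n)
      nmul e (s ^ (n.-1 - i)) (iter i (fun w => d * t w) z) =
    \prod_(i < n) iter i t (1 + e * z) ^+ (s ^ (n.-1 - i)).
Proof.
move=> te; rewrite (big_morph (fun x => 1 + e * x) (id1 := 1) (op1 := *%R)).
- apply: eq_bigr => i _; rewrite nmul_id; congr (_ ^+ _).
  rewrite rmorphD rmorph1; congr (_ + _).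
  elim: (i : nat) => //= m <-; rewrite rmorphM te; ring.
- by move=> x y; rewrite /oplus; ring.
- by rewrite mulr0 addr0.
Qed.

(** Both sides are the product of the t^i(Z)^(s^(n-i)) for i from 0 to n: the left splits off i = 0,
    the right i = n, where t^n(Z) = Z. *)
Lemma norm_twist (A : comNzRingType) (t : {rmorphism A -> A}) (Z : A) (n s : nat) :
  iter n t Z = Z ->
  let W := \prod_(i < n) iter i t Z ^+ (s ^ (n.-1 - i)) in
  t W * Z ^+ (s ^ n) = W ^+ s * Z.
Proof.
move=> tZ /=; transitivity (\prod_(i < n.+1) iter i t Z ^+ (s ^ (n - i))).
  rewrite big_ord_recl subn0 mulrC rmorph_prod; congr (_ * _).
  apply: eq_bigr => i _; rewrite rmorphXn /=; congr (_ ^+ (_ ^ _)).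
  by rewrite /bump add1n -subn1 -subnDA add1n.
rewrite big_ord_recr /= subnn expn0 expr1 tZ; congr (_ * _).
rewrite -prodrXl; apply: eq_bigr => i _; rewrite -exprM -expnSr.
by congr (_ ^+ (_ ^ _)); case: n i {tZ} => [[]//|n] i; rewrite subSn // -ltnS.
Qed.

(** Induction: t^n of the relation is combined with the s-th power of the previous case. For X =
    Theta and n = p - 1 the product is U, which decides the order of tau. *)
Lemma iter_power_relation (A : comNzRingType) (t : {rmorphism A -> A})
    (X Z : A) (n r s : nat) :
  t X * Z ^+ r = X ^+ s ->
  iter n t X * (\prod_(i < n) iter i t Z ^+ (s ^ (n.-1 - i))) ^+ r = X ^+ (s ^ n).
Proof.
move=> tX; elim: n => [|n IH]; first by rewrite big_ord0 expr1n mulr1 expn0 expr1.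
rewrite expnSr exprM -IH exprMn -rmorphXn /= -tX.
rewrite big_ord_recr /= subnn expn0 expr1 rmorphM rmorphXn /= -iterS iterSr.
rewrite -!mulrA; congr (_ * _); rewrite exprMn mulrC; congr (_ * _).
rewrite -!exprM [(r * s)%N]mulnC exprM; congr (_ ^+ _).
rewrite -prodrXl; apply: eq_bigr => i _; rewrite -exprM -expnSr.
by congr (_ ^+ (_ ^ _)); case: n i {IH} => [[]//|n] i; rewrite subSn // -ltnS.
Qed.

Lemma exprDn2 (A : comNzRingType) (a : A) n :
  exists c, (1 + a) ^+ n = 1 + n%:R * a + a * a * c.
Proof.
elim: n => [|n [c cE]]; first by exists 0; rewrite expr0; ring.
by exists (n%:R + c + a * c); rewrite exprS cE -natr1; ring.
Qed.

(** * The extension S/R *)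

Lemma unit_reg (A : comNzRingType) (a b : A) : is_unit a -> a * b = 0 -> b = 0.
Proof. by case=> a' aE ab; rewrite -[b]mul1r -aE mulrAC ab mul0r. Qed.

Lemma unit_morph (A B : comNzRingType) (f : {rmorphism A -> B}) a :
  is_unit a -> is_unit (f a).
Proof. by case=> b ab; exists (f b); rewrite -rmorphM ab rmorph1. Qed.

Lemma unitM (A : comNzRingType) (a b : A) : is_unit a -> is_unit b -> is_unit (a * b).
Proof. by case=> a' aE [b' bE]; exists (a' * b'); rewrite mulrACA aE bE mulr1. Qed.

Lemma unitX (A : comNzRingType) (a : A) n : is_unit a -> is_unit (a ^+ n).
Proof. by case=> b ab; exists (b ^+ n); rewrite -exprMn ab expr1n. Qed.

Lemma unit_prod (A : comNzRingType) n (F : 'I_n -> A) :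
  (forall i, is_unit (F i)) -> is_unit (\prod_i F i).
Proof.
move=> FU; elim/big_ind: _ => [|a b|i _]; [by exists 1; rewrite mulr1|exact: unitM|].
exact: FU.
Qed.

Lemma unit_factor (A : comNzRingType) (a b : A) : is_unit (a * b) -> is_unit a.
Proof. by case=> c abc; exists (b * c); rewrite mulrA. Qed.

Section Extension.
Variables (p : nat) (p_pr : prime p).
Notation rho := (rhoZ p).
Notation eta := (etaZ p).
Variables (xi : Zrho p) (xi_unit : is_unit xi) (xi_eq : p%:R = xi * eta ^+ p.-1).
Variables (tau : {rmorphism Zrho p -> Zrho p}) (s r : nat).
Hypotheses (tau_rho : tau rho = rho ^+ s) (s_exp : (s ^ p.-1)%N = (p * r).+1).
Hypothesis s_order : forall m, (0 < m)%N -> s ^ m = 1 %[mod p] -> (p.-1 <= m)%N.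
Variables (R : comNzRingType) (alg : {rmorphism Zrho p -> R}).
Variables (tauR : {rmorphism R -> R}) (z u : R).
Hypotheses (R_reg : forall a : R, a *+ p = 0 -> a = 0)
  (tauR_alg : forall a, tauR (alg a) = alg (tau a))
  (tauR_order : forall a, iter p.-1 tauR a = a).
Let Z := 1 + alg (eta ^+ p) * z.
Hypotheses (Z_unit : is_unit Z)
  (uE : 1 + alg (eta ^+ p) * u =
        \prod_(i < p.-1) iter i tauR Z ^+ (s ^ (p.-2 - i))).

Definition kummer_poly : {poly R} := 'X^p + map_poly alg (gpoly xi) - u%:P.
Notation f := kummer_poly.
Notation S := {poly %/ f}.

Let p_gt0 : (0 < p)%N := prime_gt0 p_pr.
Let p_gt1 : (1 < p)%N := prime_gt1 p_pr.

Let s_p : coprime s p.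
Proof.
rewrite -(coprime_pexpl (k := p.-1)); last by rewrite -ltnS prednK.
by rewrite s_exp coprime_sym -addn1 [(p * r)%N]mulnC /coprime gcdnMDl gcdn1.
Qed.

Lemma size_kummer_tail : (size (map_poly alg (gpoly xi) - u%:P)%R <= p)%N.
Proof.
rewrite (leq_trans (size_polyD _ _)) // geq_max size_polyN size_polyC.
rewrite [X in _ && X](leq_trans (leq_b1 _)) // andbT (leq_trans (size_poly _ _)) //.
rewrite (leq_trans (size_scale_leq _ _)) // big_nat.
apply: (big_ind (fun q : {poly _} => size q <= p)%N) => [|a b sa sb|i /andP[_ ip]].
- by rewrite size_poly0.
- by rewrite (leq_trans (size_polyD _ _)) // geq_max sa.
- by rewrite (leq_trans (size_scale_leq _ _)) // size_polyXn.
Qed.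

Lemma size_kummer : size f = p.+1.
Proof. by rewrite /f -addrA size_polyDl size_polyXn // ltnS size_kummer_tail. Qed.

Lemma kummer_monic : f \is monic.
Proof.
rewrite monicE /f -addrA lead_coefDl ?lead_coefXn //.
by rewrite size_polyXn ltnS size_kummer_tail.
Qed.

Let f_gt1 : (1 < size f)%N. Proof. by rewrite size_kummer ltnS. Qed.

Lemma kummer_horner (B : comNzRingType) (phi : {rmorphism R -> B}) b :
  (map_poly phi f).[b] = b ^+ p + (map_poly (phi \o alg) (gpoly xi)).[b] - phi u.
Proof.
rewrite /f rmorphB rmorphD /= map_polyXn map_polyC -map_poly_comp.
by rewrite hornerD hornerN hornerC hornerD hornerXn.
Qed.

(** By [kummer_id], eta^p times the value of f vanishes, and eta^p is regular. Morphisms out of S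
    can thus be checked on Theta. *)
Lemma kummer_root (B : comNzRingType) (phi : {rmorphism R -> B}) b :
  (forall x : B, x *+ p = 0 -> x = 0) ->
  (1 + phi (alg eta) * b) ^+ p = 1 + phi (alg eta) ^+ p * phi u ->
  (map_poly phi f).[b] = 0.
Proof.
move=> preg bE; have reg := eta_reg p_pr xi_eq (psi := phi \o alg) preg.
rewrite kummer_horner.
have regX n : forall x, phi (alg eta) ^+ n * x = 0 -> x = 0.
  elim: n => [|n IH] x; first by rewrite mul1r.
  by rewrite exprS -mulrA => /reg/IH.
apply: (regX p); rewrite mulrBr (kummer_id p_pr xi_eq (phi \o alg)) /= bE.
by rewrite [1 + _]addrC addrK subrr.
Qed.

Let S_reg : forall b : S, b *+ p = 0 -> b = 0.
Proof. exact: qpoly_reg R_reg. Qed.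

Let algS : {rmorphism Zrho p -> S} := qpolyC f \o alg.
Let theta : S := 'qX.

Let algS_reg := eta_reg p_pr xi_eq (psi := algS) S_reg.

Lemma Theta_expp : (1 + algS eta * theta) ^+ p = qpolyC f (1 + alg (eta ^+ p) * u).
Proof.
have := qpoly_root f_gt1 kummer_monic; rewrite kummer_horner.
move=> /(congr1 ( *%R (algS eta ^+ p))).
rewrite mulr0 mulrBr (kummer_id p_pr xi_eq algS) => /eqP.
rewrite subr_eq0 subr_eq => /eqP ->.
rewrite [RHS]rmorphD rmorph1 [X in _ = 1 + X]rmorphM rmorphXn rmorphXn /=.
by rewrite [LHS]addrC.
Qed.

Lemma u_unit : is_unit (1 + alg (eta ^+ p) * u).
Proof.
rewrite uE; apply: unit_prod => i; apply: unitX.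
exact: (unit_morph (iter i tauR : {rmorphism R -> R})).
Qed.

Lemma Theta_unit : is_unit (1 + algS eta * theta).
Proof.
apply: (@unit_factor _ _ ((1 + algS eta * theta) ^+ p.-1)).
rewrite -exprS prednK // Theta_expp; apply: unit_morph; exact: u_unit.
Qed.

Lemma kummer_sigma : exists sigma : {rmorphism S -> S},
  [/\ forall a, sigma (qpolyC f a) = qpolyC f a,
      sigma theta = algS rho * theta + 1 & forall b, iter p sigma b = b].
Proof.
have [|sigma [sigmaC sigmaX]] := qpoly_lift f_gt1 kummer_monic
    (phi := qpolyC f) (b := algS rho * theta + 1).
  apply: kummer_root => //; 
  suff: (1 + algS eta * (algS rho * theta + 1)) ^+ p =
      1 + algS eta ^+ p * qpolyC f u by [].
  have -> : 1 + algS eta * (algS rho * theta + 1) =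
      algS rho * (1 + algS eta * theta).
    have -> : algS rho = 1 + algS eta.
      by rewrite -[in LHS](etaE p) [LHS]rmorphD rmorph1.
    by move: (algS eta) => e; ring.
  have rp : algS rho ^+ p = 1 by rewrite -rmorphXn (rho_expp p_pr) rmorph1.
  rewrite exprMn rp mul1r Theta_expp.
  by rewrite [LHS]rmorphD rmorph1 [X in 1 + X = _]rmorphM rmorphXn rmorphXn.
exists sigma; split=> //.
have sigma_psi a : sigma (algS a) = algS a by exact: sigmaC.
apply: (qpoly_ext (F := iter p sigma : {rmorphism S -> S}) (G := idfun)) => [a|].
  by rewrite /=; elim: (p) => //= n ->.
rewrite /= (iter_sigma_theta sigma_psi sigmaX) (rho_expp p_pr).
by rewrite /deltaZ (sum_rho p_pr) rmorph0 rmorph1 mul1r addr0.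
Qed.

Section SigmaAction.
Variable sigma : {rmorphism S -> S}.
Hypotheses (sigmaC : forall a, sigma (qpolyC f a) = qpolyC f a)
  (sigmaX : sigma theta = algS rho * theta + 1)
  (sigma_p : forall b, iter p sigma b = b).

Let sigma_psi a : sigma (algS a) = algS a. Proof. exact: sigmaC. Qed.

Let diff_unit k : (0 < k < p)%N -> is_unit (theta - iter k sigma theta).
Proof.
move=> /andP[k_gt0 kp].
apply: (theta_sub_iter_unit p_pr xi_eq sigma_psi sigmaX Theta_unit).
by rewrite coprime_sym prime_coprime // gtnNdvd.
Qed.

Lemma kummer_fixed b : sigma b = b -> exists a, b = qpolyC f a.
Proof.
apply: (@qpoly_fixed _ _ p.-1) => //; rewrite ?prednK //.
- exact: kummer_monic.
- exact: size_kummer.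
move=> i j /andP[ij jp] {}b; apply: unit_reg.
(* Differences of conjugates are conjugates of the units theta - sigma^(j-i)(theta). *)
have -> : iter i sigma 'qX - iter j sigma 'qX =
    iter i sigma (theta - iter (j - i) sigma theta).
  by rewrite rmorphB /= -iterD subnKC // ltnW.
apply: (unit_morph (iter i sigma : {rmorphism S -> S})); apply: diff_unit.
by rewrite subn_gt0 ij (leq_ltn_trans (leq_subr _ _)).
Qed.

Lemma kummer_galois : galois_cyclic (qpolyC f) sigma p.
Proof.
apply: galois_cyclicI => //; [exact: qpolyC_inj|exact: kummer_fixed|].
move=> k /diff_unit[v vE]; rewrite -vE mulrC.
exact/moved_idealMl/moved_idealB.
Qed.

Let Zs : S := qpolyC f Z.

(** [X] is a candidate for tau(Theta). Its p-th power satisfies X^p Z^(pr) = U^s, while [norm_twist]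
    gives tau(U) Z^(pr+1) = U^s Z; the unit Z cancels. *)
Lemma tau_shift_expp (X : S) : X * Zs ^+ r = (1 + algS eta * theta) ^+ s ->
  X ^+ p = qpolyC f (tauR (1 + alg (eta ^+ p) * u)).
Proof.
move=> XE; set W := 1 + _ * u.
have WE : tauR W * Z ^+ (s ^ p.-1) = W ^+ s * Z.
  by rewrite /W uE; apply: norm_twist.
have [v vE] := unitX (p * r).+1 (unit_morph (qpolyC f) Z_unit).
have cancelZ a b : a * Zs ^+ (p * r).+1 = b * Zs ^+ (p * r).+1 -> a = b.
  by move=> /(congr1 ( *%R^~ v)); rewrite -!mulrA vE !mulr1.
have rhs : qpolyC f (tauR W) * Zs ^+ (p * r).+1 = qpolyC f W ^+ s * Zs.
  by rewrite -rmorphXn -rmorphM -s_exp WE rmorphM rmorphXn.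
apply: cancelZ; rewrite rhs exprSr mulrA; congr (_ * _).
rewrite [(p * r)%N]mulnC exprM -exprMn XE -exprM mulnC exprM Theta_expp.
by [].
Qed.

(** The last clause records tau(Theta) Z^r = Theta^s, the form from which the order of tau, its
    commutation with sigma and its reduction modulo eta are derived. *)
Lemma kummer_tau : exists (tauS : {rmorphism S -> S}) (w : S) (delta_inv : Zrho p),
  [/\ forall a, tauS (qpolyC f a) = qpolyC f (tauR a),
      is_ominus (algS eta) (nmul (algS eta) s theta)
        (qpolyC f (nmul (alg (eta ^+ p)) r z) * algS (eta ^+ p.-1)) w,
      deltaZ p s * delta_inv = 1,
      tauS theta = algS delta_inv * w
    & (1 + algS (tau eta) * tauS theta) * Zs ^+ r = (1 + algS eta * theta) ^+ s].
Proof.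
have [d dE] := deltaZ_unit p_pr xi_eq s_p.
set y := qpolyC f _ * _.
(* The factor eta^(p-1) of [y] completes eta to eta^p, the scalar of the p-version of the
   operations. *)
have yE : 1 + y * algS eta = Zs ^+ r.
  rewrite /Zs /Z -rmorphXn -nmul_id [RHS]rmorphD rmorph1; congr (1 + _).
  rewrite /y -mulrA -rmorphM -exprSr prednK // mulrC [RHS]rmorphM.
  by [].
have y_unit : is_unit (1 + y * algS eta).
  by rewrite yE; apply/unitX/unit_morph.
have [v vE] := y_unit.
pose w := (nmul (algS eta) s theta - y) * v.
have wE : nmul (algS eta) s theta = oplus (algS eta) y w.
  transitivity (y + (1 + y * algS eta) * v * (nmul (algS eta) s theta - y)).
    by rewrite vE mul1r addrC subrK.
  by rewrite /oplus /w; move: (algS eta) => e; ring.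
pose x := algS d * w.
(* The factor 1/delta cancels against tau(eta) = delta eta. *)
have tau_etaE : algS (tau eta) * x = algS eta * w.
  rewrite (tau_eta tau_rho) /x.
  transitivity (algS (deltaZ p s * d) * (algS eta * w)); last first.
    by rewrite dE rmorph1 mul1r.
  by rewrite !(rmorphM algS); move: (algS eta) => e; ring.
have xE : (1 + algS (tau eta) * x) * Zs ^+ r = (1 + algS eta * theta) ^+ s.
  rewrite -nmul_id tau_etaE -yE wE /oplus.
  by move: (algS eta) => e; ring.
have [|tauS [tauC tauX]] := qpoly_lift f_gt1 kummer_monic
    (phi := qpolyC f \o tauR) (b := x).
  apply: kummer_root => //=; rewrite tauR_alg.
  rewrite (tau_shift_expp xE).
  have -> : tauR (1 + alg (eta ^+ p) * u) = 1 + alg (tau eta) ^+ p * tauR u.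
    by rewrite [LHS]rmorphD rmorph1 [X in 1 + X = _]rmorphM tauR_alg !rmorphXn.
  by rewrite [LHS]rmorphD rmorph1 [X in 1 + X = _]rmorphM rmorphXn.
exists tauS, w, d; split=> //; last by rewrite tauX.
split=> //; split=> // w' w'E.
have := w'E; rewrite wE /oplus => /eqP; rewrite -!addrA (can_eq (addKr y)) => /eqP h.
have {}h : (1 + y * algS eta) * (w - w') = 0.
  rewrite mulrBr; apply/eqP; rewrite subr_eq0; apply/eqP.
  move: h; move: (algS eta) => e h.
  by transitivity (w + y * w * e); [ring | rewrite h; ring].
by apply/eqP; rewrite -subr_eq0; apply/eqP/(unit_reg y_unit).
Qed.

Section TauAction.
Variables (tauS : {rmorphism S -> S}).
Hypotheses (tauSC : forall a, tauS (qpolyC f a) = qpolyC f (tauR a))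
  (tauSX : (1 + algS (tau eta) * tauS theta) * Zs ^+ r =
           (1 + algS eta * theta) ^+ s).

Let Theta : S := 1 + algS eta * theta.

Let tauS_alg a : tauS (algS a) = algS (tau a).
Proof. by rewrite /algS /= tauSC tauR_alg. Qed.

Let tau_Theta : tauS Theta = 1 + algS (tau eta) * tauS theta.
Proof. by rewrite /Theta [LHS]rmorphD rmorph1 rmorphM tauS_alg. Qed.

Let iter_tauS n a : iter n tauS (qpolyC f a) = qpolyC f (iter n tauR a).
Proof. by elim: n => //= n ->. Qed.

Let Theta_inj (a b : S) : 1 + algS eta * a = 1 + algS eta * b -> a = b.
Proof.
move=> e; apply/eqP; rewrite -subr_eq0; apply/eqP/algS_reg.
by rewrite mulrBr -[X in X - _](addKr 1) e addKr subrr.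
Qed.

Lemma tauS_order b : iter p.-1 tauS b = b.
Proof.
apply: (qpoly_ext (F := iter p.-1 tauS : {rmorphism S -> S}) (G := idfun)) => [a|].
  by rewrite /= iter_tauS tauR_order.
rewrite /=; apply: Theta_inj; rewrite -/theta.
have -> : 1 + algS eta * iter p.-1 tauS theta = iter p.-1 tauS Theta.
  by rewrite /Theta [RHS]rmorphD rmorph1 rmorphM /= iter_tauS tauR_order.
have := iter_power_relation p.-1 (etrans (congr1 ( *%R^~ _) tau_Theta) tauSX).
have -> : \prod_(i < p.-1) iter i tauS Zs ^+ (s ^ (p.-1.-1 - i)) = Theta ^+ p.
  rewrite Theta_expp uE rmorph_prod; apply: eq_bigr => i _.
  by rewrite rmorphXn /= iter_tauS.
(* As s^(p-1) = pr + 1 and U = Theta^p, the relation reads tau^(p-1)(Theta) Theta^(pr) = Theta^(pr)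
   Theta. *)
rewrite s_exp exprSr exprM mulrC.
have [v vE] := unitX r (unitX p Theta_unit).
by move=> /(congr1 ( *%R v)); rewrite !mulrA [v * _]mulrC vE !mul1r.
Qed.

(** As sigma fixes Z, it multiplies tau(Theta) = Theta^s/Z^r by rho^s = tau(rho), just as tau does
    to rho Theta. *)
Lemma sigma_tauS b : sigma (tauS b) = tauS (sigma b).
Proof.
move: b.
have sigma_Theta : sigma Theta = algS rho * Theta.
  have -> : sigma Theta = 1 + algS eta * (algS rho * theta + 1).
    by rewrite /Theta [LHS]rmorphD rmorph1 rmorphM sigmaX sigmaC.
  have -> : algS rho = 1 + algS eta.
    by rewrite -[in LHS](etaE p) [LHS]rmorphD rmorph1.
  by rewrite /Theta; move: (algS eta) => e; ring.
apply: (qpoly_ext (F := sigma \o tauS : {rmorphism S -> S})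
  (G := tauS \o sigma : {rmorphism S -> S})) => [a|] /=.
  by rewrite sigmaC !tauSC sigmaC.
have [v vE] := unitX r (unit_morph (qpolyC f) Z_unit).
have key : sigma (tauS Theta) = tauS (sigma Theta).
  rewrite sigma_Theta [RHS]rmorphM tauS_alg tau_rho.
  have sE := congr1 sigma tauSX; rewrite -tau_Theta in sE.
  move: sE; rewrite rmorphM rmorphXn sigmaC rmorphXn sigma_Theta exprMn -tauSX.
  rewrite -tau_Theta mulrA => /(congr1 ( *%R^~ v)).
  by rewrite -!mulrA vE !mulr1 rmorphXn.
(* Applying tau to the equation of p shows that tau(eta) divides p as well. *)
have tau_reg b : algS (tau eta) * b = 0 -> b = 0.
  exact: (eta_reg p_pr xi_eq (psi := algS \o tau) S_reg).
apply/eqP; rewrite -subr_eq0; apply/eqP/tau_reg; rewrite mulrBr.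
have e1 : sigma (tauS Theta) = 1 + algS (tau eta) * sigma (tauS theta).
  by rewrite tau_Theta [LHS]rmorphD rmorph1 rmorphM sigmaC.
have e2 : tauS (sigma Theta) = 1 + algS (tau eta) * tauS (sigma theta).
  have -> : sigma Theta = 1 + algS eta * sigma theta.
    by rewrite /Theta [LHS]rmorphD rmorph1 rmorphM sigmaC.
  by rewrite [LHS]rmorphD rmorph1 rmorphM tauS_alg.
by move: key; rewrite e1 e2 => /addrI ->; rewrite subrr.
Qed.

(** Modulo eta^2, the relation tau(Theta) Z^r = Theta^s reads delta eta tau(theta) = s eta theta.
    Cancel eta, then the unit delta, which is s modulo eta. *)
Lemma tauS_theta_mod_eta : exists t, tauS theta = theta + algS eta * t.
Proof.
have [c cE] := exprDn2 (algS eta * theta) s.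
have [d dE] := deltaZ_unit p_pr xi_eq s_p.
have [e eE] := deltaZ_mod_eta p s.
(* Z^r is 1 modulo eta^p, and p >= 2 allows eta^2 to be split off. *)
pose q := algS (eta ^+ p.-2) * qpolyC f (nmul (alg (eta ^+ p)) r z).
have etaX : algS eta * algS eta * algS (eta ^+ p.-2) = qpolyC f (alg (eta ^+ p)).
  rewrite -!(rmorphM algS) -mulrA -!exprS.
  by have -> : p.-2.+2 = p by rewrite !prednK // -ltnS prednK.
have ZE : Zs ^+ r = 1 + algS eta * algS eta * q.
  rewrite /Zs /Z -rmorphXn -nmul_id [LHS]rmorphD rmorph1; congr (1 + _).
  by rewrite /q mulrA etaX [LHS]rmorphM.
have sE : (s%:R : S) = algS (deltaZ p s) - algS eta * algS e.
  by rewrite eE [X in X - _]rmorphD rmorphM rmorph_nat addrK.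
pose x := tauS theta; pose D := algS (deltaZ p s).
have rel : D * (x - theta) =
    algS eta * (theta * theta * c - algS e * theta - q * (1 + algS eta * D * x)).
  apply/eqP; rewrite -subr_eq0; apply/eqP/algS_reg.
  have := tauSX; rewrite ZE cE sE (tau_eta tau_rho) [algS (_ * _)]rmorphM -/D -/x.
  move: (algS eta) (algS e) => h e0 /eqP; rewrite -subr_eq0 => /eqP rel0.
  by rewrite -[RHS]rel0; ring.
exists (algS d * (theta * theta * c - algS e * theta - q * (1 + algS eta * D * x))).
apply/eqP; rewrite addrC -subr_eq; apply/eqP.
transitivity (algS (deltaZ p s * d) * (x - theta)).
  by rewrite dE rmorph1 mul1r.
rewrite rmorphM mulrAC mulrC mulrA [_ * D * _]mulrAC -mulrA rel.
by move: (algS eta) => h; ring.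
Qed.

Lemma kummer_descent (j_tau : forall a, qpolyC f (tauR a) = tauS (qpolyC f a))
    (sigma_tau : forall b, sigma (tauS b) = tauS (sigma b)) :
  galois_cyclic (fixmap j_tau) (fixmap sigma_tau) p.
Proof.
apply: galois_cyclicI => //.
- move=> b; apply: val_inj => /=.
  by rewrite (fixval_iter_sigmaF (sigma := sigma)).
- move=> a b /(congr1 (@fixval _ _)) /qpolyC_inj; exact: val_inj.
- by move=> a; apply: val_inj; apply: sigmaC.
- move=> b /(congr1 (@fixval _ _)) /= /kummer_fixed[a aE].
  have a_fixed : fixed_by tauR a.
    apply/eqP/(@qpolyC_inj _ f); rewrite j_tau -aE; exact/eqP/(valP b).
  by exists (Fixring a_fixed); apply: val_inj.
move=> k k_p.
apply: (descent_moved p_pr xi_unit xi_eq s_p s_order tau_rho S_reg sigma_tau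
  tauS_order sigma_psi tauS_alg sigmaX Theta_unit tauS_theta_mod_eta _ k_p).
by [].
Qed.

End TauAction.
End SigmaAction.
End Extension.

(** * The polynomial ring R', its localization, and the theorem *)

Lemma mpoly_reg (A : nzRingType) m n : (forall a : A, a *+ n = 0 -> a = 0) ->
  forall q : {mpoly A[m]}, q *+ n = 0 -> q = 0.
Proof.
move=> nreg q q0; apply/mpolyP => i; rewrite mcoeff0; apply: nreg.
by rewrite -mcoeffMn q0 mcoeff0.
Qed.

Lemma iter_tau' p (tau : {rmorphism Zrho p -> Zrho p}) n q i :
  (iter n (tau' tau) q)@_i = iter n tau q@_i.
Proof. by elim: n => //= n <-; rewrite mcoeff_map_mpoly. Qed.

Lemma tau'_mpolyC p (tau : {rmorphism Zrho p -> Zrho p}) a :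
  tau' tau a%:MP = (tau a)%:MP.
Proof. exact: map_mpolyC. Qed.

(** Applying [t] permutes the factors cyclically. For C this lets tau extend to the localization. *)
Lemma iter_prod_fixed (A : comNzRingType) (t : {rmorphism A -> A}) n (x : A) :
  iter n t x = x ->
  t (\prod_(i < n) iter i t x) = \prod_(i < n) iter i t x.
Proof.
case: n => [|n] tx; first by rewrite !big_ord0 rmorph1.
rewrite rmorph_prod big_ord_recr [RHS]big_ord_recl /= mulrC; congr (_ * _).
exact: tx.
Qed.

Theorem theorem2p5
  (p : nat) (p_pr : prime p)
  (xi : Zrho p) (xi_unit : is_unit xi)
  (xi_eq : p%:R = xi * etaZ p ^+ p.-1)
  (tau : {rmorphism Zrho p -> Zrho p}) (tau_gen : gal_generator tau)
  (s r : nat) (s_gt0 : (0 < s)%N)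
  (tau_rho : tau (rhoZ p) = rhoZ p ^+ s)
  (r_eq : (s ^ p.-1 - 1 = p * r)%N) (r_p : coprime r p)
  (R : comNzRingType) (iota : {rmorphism {mpoly (Zrho p)[p.-1]} -> R})
  (R_loc : is_localization_away (Cgen tau) iota) :
  let alg : {rmorphism Zrho p -> R} := iota \o @mpolyC p.-1 (Zrho p) in
  let z : R := iota (zgen p) in
  let u : R := iota (Nmap s tau (zgen p)) in
  let f : {poly R} := 'X^p + map_poly alg (gpoly xi) - u%:P in
  let j : {rmorphism R -> {poly %/ f}} := qpolyC f in
  let algS : {rmorphism Zrho p -> {poly %/ f}} := j \o alg in
  let theta : {poly %/ f} := 'qX in
  exists sigma : {rmorphism {poly %/ f} -> {poly %/ f}},
  [/\ forall a, sigma (j a) = j a,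
      sigma theta = algS (rhoZ p) * theta + 1,
      galois_cyclic j sigma p
    & exists tauR : {rmorphism R -> R},
      (forall a, tauR (iota a) = iota (tau' tau a)) /\
      exists (tauS : {rmorphism {poly %/ f} -> {poly %/ f}})
             (j_tau : forall a, j (tauR a) = tauS (j a))
             (sigma_tau : forall b, sigma (tauS b) = tauS (sigma b)),
      [/\ bijective tauS,
          exists (w : {poly %/ f}) (delta_inv : Zrho p),
            [/\ is_ominus (algS (etaZ p)) (nmul (algS (etaZ p)) s theta)
                  (j (nmul (alg (etaZ p ^+ p)) r z) * algS (etaZ p ^+ p.-1)) w,
                deltaZ p s * delta_inv = 1
              & tauS theta = algS delta_inv * w],
          forall b, iter p.-1 tauS b = b
        & galois_cyclic (fixmap j_tau) (fixmap sigma_tau) p]].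
Proof.
move=> alg z u f j algS theta.
have p_gt0 := prime_gt0 p_pr; have p_gt1 := prime_gt1 p_pr.
have p1_gt0 : (0 < p.-1)%N by rewrite -ltnS prednK.
have s_exp : (s ^ p.-1)%N = (p * r).+1.
  by rewrite -r_eq -addn1 subnK // expn_gt0 s_gt0.
have s_order m := gal_generator_order p_pr tau_gen tau_rho (m := m).
have tau_order : forall a, iter p.-1 tau a = a.
  apply: (Zrho_ext (F := iter p.-1 tau : {rmorphism _ -> _}) (G := idfun)) => /=.
  have -> n : iter n tau (rhoZ p) = rhoZ p ^+ (s ^ n).
    by elim: n => //= n ->; rewrite rmorphXn /= tau_rho -exprM expnS.
  by rewrite s_exp exprS exprM (rho_expp p_pr) expr1n mulr1.
have tau'_order q : iter p.-1 (tau' tau) q = q.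
  by apply/mpolyP => i; rewrite iter_tau' tau_order.
have R_reg : forall a : R, a *+ p = 0 -> a = 0.
  apply: (localization_reg R_loc); apply: mpoly_reg; exact: Zrho_reg.
have C_unit : is_unit (iota (Cgen tau)) by have [] := R_loc.
have tauC : tau' tau (Cgen tau) = Cgen tau.
  exact/iter_prod_fixed/tau'_order.
have [|tauR tauR_iota] :=
    localization_lift R_loc (phi := iota \o tau' tau : {rmorphism _ -> _}).
  by rewrite /= tauC.
have tauR_iter n a : iter n tauR (iota a) = iota (iter n (tau' tau) a).
  by elim: n => //= n ->; rewrite tauR_iota.
have tauR_order : forall a, iter p.-1 tauR a = a.
  apply: (localization_ext (F := iter p.-1 tauR : {rmorphism _ -> _})
    (G := idfun) R_loc) => a /=.
  by rewrite tauR_iter tau'_order.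
have tauR_alg a : tauR (alg a) = alg (tau a).
  by rewrite /alg /= tauR_iota /= tau'_mpolyC.
pose Z0 : {mpoly (Zrho p)[p.-1]} := 1 + (etaZ p ^+ p)%:MP * zgen p.
have ZE : 1 + alg (etaZ p ^+ p) * z = iota Z0.
  by rewrite [RHS]rmorphD rmorph1 [X in _ = 1 + X]rmorphM.
(* Z is the factor of index 0 of C, and a divisor of a unit is a unit. *)
have Z_unit : is_unit (1 + alg (etaZ p ^+ p) * z).
  rewrite ZE; move: C_unit; rewrite /Cgen [zgen p * _]mulrC -/Z0.
  rewrite (bigD1 (Ordinal p1_gt0)) //= rmorphM; exact: unit_factor.
have uE : 1 + alg (etaZ p ^+ p) * u =
    \prod_(i < p.-1) iter i tauR (1 + alg (etaZ p ^+ p) * z) ^+ (s ^ (p.-2 - i)).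
  rewrite ZE /u /Nmap.
  transitivity (iota (\prod_(i < p.-1) iter i (tau' tau) Z0 ^+ (s ^ (p.-2 - i)))).
    rewrite -(@norm_id _ (tau' tau) (etaZ p ^+ p)%:MP (deltaZ p s ^+ p)%:MP).
      by rewrite [RHS]rmorphD rmorph1 [X in _ = 1 + X]rmorphM.
    by rewrite tau'_mpolyC rmorphXn (tau_eta tau_rho) exprMn mpolyCM.
  by rewrite rmorph_prod; apply: eq_bigr => i _; rewrite rmorphXn tauR_iter.
have [sigma [sigmaC sigmaX sigma_p]] := kummer_sigma p_pr xi_eq alg u R_reg.
have [tauS [w [d [tauSC wE dE tauSX key]]]] :=
  kummer_tau p_pr xi_eq tau_rho s_exp R_reg tauR_alg tauR_order Z_unit uE.
exists sigma; split=> //.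
  exact: (kummer_galois p_pr xi_eq Z_unit uE).
exists tauR; split=> //.
have j_tau a : j (tauR a) = tauS (j a) by rewrite /j tauSC.
have tS := tauS_order p_pr xi_eq s_exp R_reg tauR_alg tauR_order Z_unit uE tauSC key.
have sigma_tau := sigma_tauS p_pr xi_eq tau_rho R_reg tauR_alg Z_unit
  sigmaC sigmaX tauSC key.
exists tauS, j_tau, sigma_tau; split=> //.
(* The inverse of tau is tau^(p-2), because tau^(p-1) = 1. *)
- exists (iter p.-2 tauS) => b; rewrite -?iterS -?iterSr prednK ?tS //.
- by exists w, d.
exact: (kummer_descent p_pr xi_unit xi_eq tau_rho s_exp s_order R_reg tauR_alg
  tauR_order Z_unit uE).
Qed.
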